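(* Let $R$ be a finite set of slopes containing $0,1,\infty$, of cardinality $k+3$ (so $R=\{0,1,\infty,r_1,\dots,r_k\}$), and let $s$ be a slope not lying in $R$. Write $D=\max(1,D(R;s))$. (i) (Three slopes) If $k=0$, then $$2-\frac{c_2}{D}\le \mathrm{SD}(R;s)\le 2-\frac{c_1}{D}$$ for some absolute constants $c_2>c_1>0$. (ii) (Many slopes) In general, $$2-\frac{C_k\log(2+D)}{D}\le \mathrm{SD}(R;s)\le 2-\frac{c_k}{D^{k+1}}$$ for some constants $c_k,C_k>0$ depending only on $k$.
   Context: A slope is an element of $\mathbb{Q}\cup\{\infty\}$. For a slope $r$ define $\pi_r:\mathbb{Q}\times\mathbb{Q}\to\mathbb{Q}$ by $\pi_r(x,y)=x+ry$ if $r\neq\infty$ and $\pi_\infty(x,y)=y$. All random variables take finitely many values. The Shannon entropy of a random variable $X$ is $\mathbf{H}[X]=\sum_x \mathbf{P}(X=x)\log\frac{1}{\mathbf{P}(X=x)}$ (with $0\log\frac10=0$). For a finite set $R$ of slopes and a slope $s\notin R$, the sum-difference constant $\mathrm{SD}(R;s)$ is the least exponent such that $\mathbf{H}[\pi_s(X,Y)]\le \mathrm{SD}(R;s)\max_{r\in R}\mathbf{H}[\pi_r(X,Y)]$ for all $\mathbb{Q}$-valued random variables $X,Y$ (not necessarily independent). Rational complexity: for $R=\{0,1,\infty,r_1,\dots,r_k\}$ and a slope $s\notin R$, $D(R;s)$ is the least natural number $D$ for which $s=P(r_1,\dots,r_k)/Q(r_1,\dots,r_k)$ with $P,Q$ polynomials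 of degree at most $D$ with integer coefficients of magnitude at most $2^D$ and $Q(r_1,\dots,r_k)\neq0$. *)

(* Defs.v *)
From HB Require Import structures.
From mathcomp Require Import all_boot all_order all_algebra finmap.
From mathcomp Require Import all_classical all_reals all_analysis.
(* The notations of mpoly clash with those of the analysis library, hence the
   selective Import. [mpoly.mpoly n A] is the type {mpoly A[n]}. *)
From mathcomp Require mpoly.
Import (canonicals, coercions) mpoly.

Set Implicit Arguments.
Unset Strict Implicit.
Unset Printing Implicit Defensive.

Import Order.TTheory GRing.Theory Num.Theory.
Local Open Scope ring_scope.

(* [None] is the slope infinity. *)
Definition slope := option rat.

Definition slope_proj (r : slope) (x y : rat) : rat :=
  if r is Some q then x + q * y else y.

Definition base_slopes : {fset slope} := [fset Some 0; Some 1; None]%fset.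

Record fdist (R : realType) (Om : finType) := FDist {
  pmf :> Om -> R;
  pmf_ge0 : forall w, 0 <= pmf w;
  pmf_sum1 : \sum_w pmf w = 1 }.

Definition Prob_eq (R : realType) (Om : finType) (P : fdist R Om)
    (T : eqType) (Z : Om -> T) (z : T) : R :=
  \sum_(w | Z w == z) P w.

(* A value of probability 0 contributes 0 * ln 0^-1 = 0. *)
Definition entropy (R : realType) (Om : finType) (P : fdist R Om)
    (T : eqType) (Z : Om -> T) : R :=
  \sum_(z <- undup (codom Z)) Prob_eq P Z z * ln (Prob_eq P Z z)^-1.

Definition proj_entropy (R : realType) (Om : finType) (P : fdist R Om)
    (X Y : Om -> rat) (r : slope) : R :=
  entropy P (fun w => slope_proj r (X w) (Y w)).

(* Entropies are nonnegative, so 0 is a harmless neutral element of the max. *)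
Definition max_proj_entropy (R : realType) (S : {fset slope}) (Om : finType)
    (P : fdist R Om) (X Y : Om -> rat) : R :=
  \big[Num.max/0]_(r <- enum_fset S) proj_entropy P X Y r.

(* Only the joint law of the finitely-valued variables X, Y matters, so they
   may be taken on an arbitrary finite probability space. *)
Definition sum_difference_exponent (R : realType) (S : {fset slope})
    (s : slope) (C : R) : Prop :=
  forall (Om : finType) (P : fdist R Om) (X Y : Om -> rat),
    proj_entropy P X Y s <= C * max_proj_entropy S P X Y.

(* The exponents are cut out by non-strict linear inequalities in C, so a
   finite infimum is attained and is the least exponent; it is +oo when there
   is no exponent at all. *)
Definition SD (R : realType) (S : {fset slope}) (s : slope) : \bar R :=
  ereal_inf [set C%:E | C in [set C : R | sum_difference_exponent S s C]]%classic.

(* The slopes r_1, ..., r_k of S other than 0, 1 and infinity, in some order. *)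
Definition other_slopes (S : {fset slope}) : seq rat :=
  pmap id (enum_fset (S `\` base_slopes)%fset).

(* [mpoly.msize p] is the total degree of p plus one, or 0 for p = 0. *)
Definition small_poly (n D : nat) (p : mpoly.mpoly n int) : Prop :=
  (mpoly.msize p <= D.+1)%N /\
  forall m, `|mpoly.mcoeff m p| <= 2 ^+ D.

Definition rat_eval (rs : seq rat) (p : mpoly.mpoly (size rs) int) : rat :=
  mpoly.mmap (intr : int -> rat) (fun i : 'I_(size rs) => rs`_i) p.

Definition rational_expr (rs : seq rat) (q : rat) (D : nat) : Prop :=
  exists P Q : mpoly.mpoly (size rs) int,
    [/\ small_poly D P, small_poly D Q, rat_eval Q != 0
      & q = rat_eval P / rat_eval Q].

Lemma small_polyC (n D : nat) (c : int) :
  `|c| <= 2 ^+ D -> small_poly D (mpoly.mpolyC n c).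
Proof.
move=> hc; split; first by rewrite mpoly.msizeC; case: (c != 0).
move=> m; rewrite mpoly.mcoeffC; case: (m == _); rewrite ?mulr1 //.
by rewrite mulr0 normr0 exprn_ge0.
Qed.

Lemma rational_expr_ex (rs : seq rat) (q : rat) :
  exists D, `[< rational_expr rs q D >].
Proof.
have bnd (m : int) D : (`|m| <= D)%N -> `|m| <= (2 : int) ^+ D.
  move=> hm; rewrite -abszE -natz -[2]/(2%:R) -natrX ler_nat.
  by apply: leq_trans hm (ltnW (ltn_expl _ _)).
exists (`|numq q| + `|denq q|)%N; apply/asboolP.
exists (mpoly.mpolyC _ (numq q)), (mpoly.mpolyC _ (denq q)); split.
- by apply/small_polyC/bnd/leq_addr.
- by apply/small_polyC/bnd/leq_addl.
- by rewrite /rat_eval mpoly.mmapC intr_eq0 denq_neq0.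
- by rewrite /rat_eval !mpoly.mmapC divq_num_den.
Qed.

(* Infinity is not a value of any P/Q; the complexity is only meaningful for
   s outside a set S that contains infinity, and 0 is a dummy value. *)
Definition rational_complexity (S : {fset slope}) (s : slope) : nat :=
  if s is Some q then ex_minn (rational_expr_ex (other_slopes S) q) else 0%N.

(* Main.v *)
Require Import Defs.
From HB Require Import structures.
From mathcomp Require Import all_boot all_order all_algebra finmap.
From mathcomp Require Import all_classical all_reals all_analysis.
From mathcomp Require Import perm.
From mathcomp Require mpoly.
Import (canonicals, coercions) mpoly.
From mathcomp Require Import ring lra zify.

(** Lower bound: let A_j be the set of values at (r_1, ..., r_k) of the integer
    polynomials of degree at most j with coefficients of size at most 2^j, and
    let X, Y be independent and uniform on A_j. For r in R the variable X + rY
    takes values in A_(j+1), whereas for j + 1 < D(R;s) the map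
    (x, y) |-> x + sy is injective on A_j x A_j, so
    SD(R;s) >= 2 ln|A_j| / ln|A_(j+1)|. As ln|A_j| grows from at least m to
    O(m^(k+1)) for j between m and 2m, with m about D/2, some j makes the last
    ratio at least 2 - O(log D / D); for k = 0 every j does, without the log.

    Upper bound: let M be the maximum of the H[pi_r(X,Y)] over r in R, and
    eta = 2M - H[X,Y]. Take copies X_1, ..., X_4 of X, independent given Y. By
    submodularity g(l) = H[X_1 - l X_2 | Y] - H[X | Y] is at most 3 eta for each
    finite nonzero l in R, and g(lm) <= g(l) + g(m),
    g(l + m) <= g(l) + g(m) + 2 g(1), g(1/l) = g(l). Horner's scheme then gives
    g(s) = O_k(D^(k+1) eta). Since H[X + sY] is at most M + 2 eta + g(s), and
    also at most H[X,Y] = 2M - eta, a convex combination gives the bound. *)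

Set Implicit Arguments.
Unset Strict Implicit.
Unset Printing Implicit Defensive.

Import Order.TTheory GRing.Theory Num.Theory.
Local Open Scope ring_scope.

(** * Shannon entropy and conditionally independent copies *)

Section Entropy.
Context {R : realType} {Om : finType} (P : fdist R Om).
Implicit Types (T : eqType).

Lemma pmf_gt0_or0 w : (P w = 0) + (0 < P w).
Proof.
by case: (ltP 0 (P w)) => Pw;
  [right | left; apply/eqP; rewrite eq_le Pw Defs.pmf_ge0].
Qed.

(** As an expectation over sample points, the entropies of variables with different value types
    become sums over one index set and can be combined termwise. *)
Lemma entropyE T (Z : Om -> T) :
  entropy P Z = \sum_w P w * ln (Prob_eq P Z (Z w))^-1.
Proof.
rewrite /entropy.
under eq_bigr => z _ do rewrite {1}/Prob_eq big_distrl /=.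
rewrite (exchange_big_dep predT) //=; apply: eq_bigr => w _.
rewrite -big_filter.
have -> : [seq z <- undup (codom Z) | Z w == z] = [:: Z w].
  rewrite (eq_filter (a2 := pred1 (Z w))); last by move=> z; rewrite /= eq_sym.
  by rewrite filter_pred1_uniq ?undup_uniq // mem_undup codom_f.
by rewrite big_seq1.
Qed.

Lemma Prob_eq_ge0 T (Z : Om -> T) z : 0 <= Prob_eq P Z z.
Proof. by apply: sumr_ge0 => w _; apply: Defs.pmf_ge0. Qed.

Lemma Prob_eq_le1 T (Z : Om -> T) z : Prob_eq P Z z <= 1.
Proof.
rewrite -(Defs.pmf_sum1 P) [leRHS](bigID (fun w => Z w == z)) /= lerDl.
by apply: sumr_ge0 => w _; apply: Defs.pmf_ge0.
Qed.

Lemma Prob_eq_gt0 T (Z : Om -> T) w : 0 < P w -> 0 < Prob_eq P Z (Z w).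
Proof.
move=> Pw; rewrite /Prob_eq (bigD1 w) //=.
by apply: ltr_wpDr => //; apply: sumr_ge0 => v _; apply: Defs.pmf_ge0.
Qed.

Lemma entropy_ge0 T (Z : Om -> T) : 0 <= entropy P Z.
Proof.
rewrite entropyE; apply: sumr_ge0 => w _.
have [P0|Pw] := pmf_gt0_or0 w; first by rewrite P0 mul0r.
rewrite mulr_ge0 ?Defs.pmf_ge0 // ln_ge0 // invf_ge1 ?Prob_eq_gt0 //.
exact: Prob_eq_le1.
Qed.

(* By [ln x <= x - 1] it suffices to bound the expectation of the likelihood
   ratio P_A P_B / (P_U P_W) by 1. *)
Lemma entropy_submod (TA TB TU TW : eqType)
    (A : Om -> TA) (B : Om -> TB) (U : Om -> TU) (W : Om -> TW) :
  (forall w v, A w = A v -> U w = U v) ->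
  (forall w v, B w = B v -> U w = U v) ->
  (forall w v, A w = A v -> B w = B v -> W w = W v) ->
  entropy P U + entropy P W <= entropy P A + entropy P B.
Proof.
move=> AU BU ABW.
pose pr (T : eqType) (Z : Om -> T) w := Prob_eq P Z (Z w).
pose ratio w := pr _ A w * pr _ B w * (pr _ U w * pr _ W w)^-1.
have ratio_le1 : \sum_w P w * ratio w <= 1.
  (* Expanding [pr _ A w] and [pr _ B w] as sums over points [w1] and [w2] turns the expectation
     into a triple sum, which is then summed over [w] first. *)
  pose S w1 w2 w := P w1 * P w2 * (P w * (pr _ U w * pr _ W w)^-1).
  have -> : \sum_w P w * ratio w =
      \sum_w1 \sum_w2 \sum_(w | (A w1 == A w) && (B w2 == B w)) S w1 w2 w.
    rewrite [RHS](eq_bigr (fun w1 => \sum_(w | A w1 == A w)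
      \sum_(w2 | B w2 == B w) S w1 w2 w)) => [|w1 _]; last first.
      rewrite (exchange_big_dep (fun w => A w1 == A w)) /=; last first.
        by move=> ? ? _ /andP[].
      by apply: eq_bigr => w Aw; apply: eq_bigl => w2; rewrite Aw.
    rewrite [RHS](exchange_big_dep predT) //=; apply: eq_bigr => w _.
    rewrite /ratio /pr {1 2}/Prob_eq mulrC -!mulrA big_distrl /=.
    apply: eq_big => [w1|w1 Aw1]; first by rewrite eq_sym.
    rewrite big_distrl big_distrr /=.
    apply: eq_big => [w2|w2 _]; first by rewrite eq_sym.
    by rewrite /S /pr; ring.
  have -> : 1 = \sum_w P w by rewrite Defs.pmf_sum1.
  apply: ler_sum => w1 _.
  have [P0|Pw1] := pmf_gt0_or0 w1.
    rewrite P0; apply: sumr_le0 => w2 _; apply: sumr_le0 => w _.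
    by rewrite /S P0 !mul0r.
  (* The points [w] of this fibre share [U] with [w1] and with [w2], and share [W] with each other.
     So the fibre is empty unless [U w1 = U w2], and otherwise its mass is at most the probability
     of its value of [W]. *)
  have inner w2 : \sum_(w | (A w1 == A w) && (B w2 == B w)) S w1 w2 w <=
      if U w2 == U w1 then P w1 * P w2 / pr _ U w1 else 0.
    pose Q w := (A w1 == A w) && (B w2 == B w).
    have [w0 /andP[/eqP Aw0 /eqP Bw0]|noQ] := pickP Q; last first.
      rewrite big_pred0 //; case: ifP => // _.
      by rewrite /pr !mulr_ge0 ?invr_ge0 ?Defs.pmf_ge0 ?Prob_eq_ge0.
    rewrite (BU _ _ Bw0) -(AU _ _ Aw0) eqxx.
    have -> : \sum_(w | Q w) S w1 w2 w =
        P w1 * P w2 / pr _ U w1 * ((\sum_(w | Q w) P w) / pr _ W w0).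
      rewrite big_distrl big_distrr /=; apply: eq_bigr => w /andP[/eqP Aw /eqP Bw].
      rewrite /S /pr -(AU _ _ Aw) (ABW w w0) -?Aw -?Bw //.
      by rewrite invfM; ring.
    apply: ler_piMr; first by rewrite /pr !mulr_ge0 ?invr_ge0 ?Defs.pmf_ge0 ?Prob_eq_ge0.
    have le_W : \sum_(w | Q w) P w <= pr _ W w0.
      rewrite /pr /Prob_eq [leRHS](bigID Q) /=.
      rewrite (eq_bigl (fun w => (W w == W w0) && Q w)) => [|w]; last first.
        rewrite andbC; case: (boolP (Q w)) => //= /andP[/eqP Aw /eqP Bw].
        by rewrite (ABW w w0) ?eqxx // -?Aw -?Bw.
      by rewrite lerDl; apply: sumr_ge0 => w _; apply: Defs.pmf_ge0.
    have [W0|W0] := ltP 0 (pr _ W w0); first by rewrite ler_pdivrMr ?mul1r.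
    have -> : pr _ W w0 = 0 by apply/eqP; rewrite eq_le W0 Prob_eq_ge0.
    by rewrite invr0 mulr0.
  apply: le_trans (ler_sum _ (fun w2 _ => inner w2)) _.
  rewrite -big_mkcond /= -big_distrl -big_distrr /= -/(Prob_eq P U (U w1)).
  by rewrite mulfK // gt_eqF // Prob_eq_gt0.
rewrite -subr_le0.
have -> : entropy P U + entropy P W - (entropy P A + entropy P B) =
   \sum_w P w * ln (ratio w).
  rewrite !entropyE -!big_split -sumrB; apply: eq_bigr => w _ /=.
  have [P0|Pw] := pmf_gt0_or0 w; first by rewrite P0 !mul0r !addr0 subrr.
  have Z0 (T : eqType) (Z : Om -> T) : Prob_eq P Z (Z w) \is Num.pos.
    by rewrite posrE Prob_eq_gt0.
  rewrite /ratio /pr ln_div ?rpredM // !lnM // !lnV //; ring.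
apply: le_trans (_ : \sum_w P w * (ratio w - 1) <= 0).
  apply: ler_sum => w _.
  have [P0|Pw] := pmf_gt0_or0 w; first by rewrite P0 !mul0r.
  rewrite ler_pM2l //.
  have r0 : 0 < ratio w by rewrite !(mulr_gt0, invr_gt0) // Prob_eq_gt0.
  have := @le_ln1Dx R (ratio w - 1); rewrite (addrC 1) subrK; apply; lra.
under eq_bigr => w _ do rewrite mulrBr mulr1.
by rewrite sumrB Defs.pmf_sum1 subr_le0.
Qed.

(** Submodularity with [A] in the roles of [A], [B] and [W]. The hypothesis says that [U] is a
    function of [A] without naming that function. *)
Lemma entropy_mono (TA TU : eqType) (A : Om -> TA) (U : Om -> TU) :
  (forall w v, A w = A v -> U w = U v) -> entropy P U <= entropy P A.
Proof.
move=> AU; rewrite -(lerD2r (entropy P A)).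
by apply: entropy_submod => // w v /AU.
Qed.

Lemma entropy_eq_ker (TA TU : eqType) (A : Om -> TA) (U : Om -> TU) :
  (forall w v, A w = A v <-> U w = U v) -> entropy P U = entropy P A.
Proof.
by move=> AU; apply/eqP; rewrite eq_le !entropy_mono // => w v /AU.
Qed.

Lemma entropy_cst : entropy P (fun=> tt) = 0.
Proof.
rewrite entropyE /Prob_eq eqxx Defs.pmf_sum1 invr1 ln1.
by rewrite big1 // => w _; rewrite mulr0.
Qed.

Lemma entropy_subadd (TA TB TW : eqType)
    (A : Om -> TA) (B : Om -> TB) (W : Om -> TW) :
  (forall w v, A w = A v -> B w = B v -> W w = W v) ->
  entropy P W <= entropy P A + entropy P B.
Proof. by move=> ABW; rewrite -[leLHS]add0r -entropy_cst entropy_submod. Qed.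

(** Values outside the range contribute 0, so variables on different sample spaces can be summed
    over one common list of values. *)
Lemma entropy_sup_codom (T : eqType) (Z : Om -> T) (s : seq T) :
  uniq s -> {subset codom Z <= s} ->
  entropy P Z = \sum_(z <- s) Prob_eq P Z z * ln (Prob_eq P Z z)^-1.
Proof.
move=> s_uniq Zs; rewrite [RHS](bigID (fun z => z \in codom Z)) /=.
rewrite [X in _ + X]big1 ?addr0 => [|z zZ]; last first.
  rewrite {1}/Prob_eq big_pred0 ?mul0r // => w.
  by apply: contraNF zZ => /eqP <-; apply: codom_f.
rewrite -big_filter; apply: perm_big; apply: uniq_perm.
- exact: undup_uniq.
- exact: filter_uniq.
move=> z; rewrite mem_undup mem_filter andbC.
by case: (boolP (z \in codom Z)) => [/Zs ->|]; rewrite ?andbF.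
Qed.

End Entropy.

Lemma entropy_same_law (R : realType) (Om Om' : finType) (P : fdist R Om)
    (P' : fdist R Om') (T : eqType) (Z : Om -> T) (Z' : Om' -> T) :
  Prob_eq P Z =1 Prob_eq P' Z' -> entropy P Z = entropy P' Z'.
Proof.
move=> law; pose s := undup (codom Z ++ codom Z').
have s_uniq : uniq s by apply: undup_uniq.
rewrite (@entropy_sup_codom _ _ _ _ _ s) //; last first.
  by move=> z zZ; rewrite mem_undup mem_cat zZ.
rewrite (@entropy_sup_codom _ _ P' _ _ s) //; last first.
  by move=> z zZ; rewrite mem_undup mem_cat zZ orbT.
by apply: eq_bigr => z _; rewrite law.
Qed.

Lemma ln_prod (R : realType) (I : finType) (F : I -> R) :
  (forall i, 0 < F i) -> ln (\prod_i F i) = \sum_i ln (F i).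
Proof.
move=> F0; suff [] : 0 < \prod_i F i /\ ln (\prod_i F i) = \sum_i ln (F i) by [].
elim/big_ind2 : _ => [|x1 x2 y1 y2 [x0 Ex] [y0 Ey]|i _]; rewrite ?ln1 //.
by rewrite mulr_gt0 // lnM ?posrE // Ex Ey.
Qed.

Section CondCopies.
Context {R : realType} {Om : finType} (P : fdist R Om) (I : finType)
  (TX TY : eqType) (X : Om -> TX) (Y : Om -> TY).

(** The law of a point [u] conditioned on [Y u = Y v]. *)
Definition cond_kernel (v u : Om) : R :=
  if Y u == Y v then P u / Prob_eq P Y (Y v) else 0.

Definition cond_copies_pmf (o : Om * {ffun I -> Om}) : R :=
  P o.1 * \prod_i cond_kernel o.1 (o.2 i).

Lemma cond_kernel_ge0 v u : 0 <= cond_kernel v u.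
Proof.
rewrite /cond_kernel; case: ifP => // _.
by rewrite mulr_ge0 ?invr_ge0 ?Defs.pmf_ge0 ?Prob_eq_ge0.
Qed.

Lemma cond_kernel_sum1 v : 0 < P v -> \sum_u cond_kernel v u = 1.
Proof.
move=> Pv; rewrite -big_mkcond /= -big_distrl /= -/(Prob_eq P Y (Y v)).
by rewrite divff // gt_eqF // Prob_eq_gt0.
Qed.

(** Absorb [F] into the [i]-th factor and exchange product and sum; every other factor then sums to
    1. *)
Lemma sum_cond_kernel (F : Om -> R) v : 0 < P v ->
  forall i, \sum_(w : {ffun I -> Om}) (\prod_j cond_kernel v (w j)) * F (w i) =
    \sum_u cond_kernel v u * F u.
Proof.
move=> Pv i.
pose G j u := if j == i then cond_kernel v u * F u else cond_kernel v u.
transitivity (\sum_(w : {ffun I -> Om}) \prod_j G j (w j)).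
  apply: eq_bigr => w _.
  rewrite (bigD1 i) //= [RHS](bigD1 i) //= /G eqxx mulrAC; congr (_ * _).
  by apply: eq_bigr => j /negbTE ->.
rewrite -(bigA_distr_bigA G) (bigD1 i) //= /G eqxx.
rewrite [X in _ * X]big1 ?mulr1 // => j /negbTE ->.
exact: cond_kernel_sum1.
Qed.

Lemma cond_copies_pmf_ge0 o : 0 <= cond_copies_pmf o.
Proof.
by rewrite mulr_ge0 ?Defs.pmf_ge0 ?prodr_ge0 // => i _; apply: cond_kernel_ge0.
Qed.

Lemma sum_prod_cond_kernel v : 0 < P v ->
  \sum_(w : {ffun I -> Om}) \prod_j cond_kernel v (w j) = 1.
Proof.
move=> Pv; rewrite -(bigA_distr_bigA (fun _ => cond_kernel v)) big1 // => j _.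
exact: cond_kernel_sum1.
Qed.

Lemma cond_copies_pmf_sum1 : \sum_o cond_copies_pmf o = 1.
Proof.
rewrite -(Defs.pmf_sum1 P) -(pair_bigA _ (fun v w => cond_copies_pmf (v, w))) /=.
apply: eq_bigr => v _; rewrite /cond_copies_pmf /= -big_distrr /=.
by have [->|Pv] := pmf_gt0_or0 P v; rewrite ?mul0r // sum_prod_cond_kernel ?mulr1.
Qed.

(* Given the value [Y v] of the first point [v], the points [w i] are
   independent copies of a point of [Om] conditioned on that value of [Y]. *)
Definition cond_copies : fdist R (Om * {ffun I -> Om})%type :=
  FDist cond_copies_pmf_ge0 cond_copies_pmf_sum1.

Lemma cond_copies_law (T : eqType) (f : TX -> TY -> T) i :
  Prob_eq cond_copies (fun o => f (X (o.2 i)) (Y o.1)) =1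
    Prob_eq P (fun w => f (X w) (Y w)).
Proof.
move=> z; rewrite /Prob_eq big_mkcond /=.
rewrite -(pair_bigA _ (fun v (w : {ffun I -> Om}) => if f (X (w i)) (Y v) == z
  then cond_copies_pmf (v, w) else 0)) /=.
pose F v u : R := (f (X u) (Y v) == z)%:R.
transitivity (\sum_v \sum_u P v * (cond_kernel v u * F v u)).
  apply: eq_bigr => v _; have [P0|Pv] := pmf_gt0_or0 P v.
    rewrite !big1 // => [u _|w _]; first by rewrite P0 mul0r.
    by rewrite /cond_copies_pmf /= P0 mul0r if_same.
  rewrite -big_distrr -(sum_cond_kernel (F v) Pv i) /= big_distrr /=.
  apply: eq_bigr => w _; rewrite /F /cond_copies_pmf /=.
  by case: ifP; rewrite ?mulr1 ?mulr0.
rewrite exchange_big [RHS]big_mkcond /=; apply: eq_bigr => u _.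
have [P0|Pu] := pmf_gt0_or0 P u.
  rewrite P0 if_same big1 // => v _; rewrite /cond_kernel P0 mul0r if_same.
  by rewrite mul0r mulr0.
(* Only the fibre of [Y] through [u] contributes, and its total mass cancels the denominator of the
   kernel. *)
transitivity (\sum_(v | Y v == Y u) P v * (P u / Prob_eq P Y (Y u) * F u u)).
  rewrite [RHS]big_mkcond; apply: eq_bigr => v _.
  rewrite /cond_kernel /F eq_sym; case: eqP => [->//|_].
  by rewrite mul0r mulr0.
rewrite -big_distrl /= -/(Prob_eq P Y (Y u)).
have pY : Prob_eq P Y (Y u) != 0 by rewrite gt_eqF // Prob_eq_gt0.
rewrite /F; case: ifP => _; last by rewrite !mulr0.
by rewrite mulr1 mulrC divfK.
Qed.

Lemma cond_copies_perm (T : eqType) (f : (I -> Om) -> Om -> T) (s : I -> I) :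
  bijective s ->
  Prob_eq cond_copies (fun o => f (fun i => o.2 (s i)) o.1) =1
    Prob_eq cond_copies (fun o => f o.2 o.1).
Proof.
case=> t st ts z; rewrite /Prob_eq.
pose h (u : I -> I) (o : Om * {ffun I -> Om}) := (o.1, [ffun i => o.2 (u i)]).
rewrite (reindex (h t)) /=; last first.
  by exists (h s) => -[v w] _; congr (_, _); apply/ffunP=> i; rewrite !ffunE ?st ?ts.
apply: eq_big => [[v w]|[v w] _] /=.
  congr (f _ _ == _); apply/funext => i; by rewrite ffunE st.
rewrite /cond_copies_pmf /=; congr (_ * _).
rewrite [RHS](reindex t) /=; last by exists s => i _; rewrite ?st ?ts.
by apply: eq_bigr => i _; rewrite ffunE.
Qed.

Lemma cond_copies_joint_prob (o : Om * {ffun I -> Om}) : 0 < P o.1 ->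
  let pY := Prob_eq P Y (Y o.1) in
  Prob_eq cond_copies (fun o => ([ffun i => X (o.2 i)], Y o.1))
    ([ffun i => X (o.2 i)], Y o.1) =
  pY * \prod_i (Prob_eq P (fun w => (X w, Y w)) (X (o.2 i), Y o.1) / pY).
Proof.
case: o => v w /= Pv; rewrite {1}/Prob_eq big_mkcond /=.
rewrite -(pair_bigA _ (fun v' (w' : {ffun I -> Om}) =>
  if ([ffun i => X (w' i)], Y v') == ([ffun i => X (w i)], Y v)
  then cond_copies_pmf (v', w') else 0)) /=.
rewrite {1}/Prob_eq big_distrl [RHS]big_mkcond /=.
apply: eq_bigr => v' _; rewrite /cond_copies_pmf /=.
have [Yv|nYv] := eqVneq (Y v') (Y v); last first.
  by rewrite big1 // => w' _; rewrite xpair_eqE (negbTE nYv) andbF.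
(* The zeros of [F] encode the event that all copies have the prescribed values of [X], one factor
   at a time, so the product of sums expands into the sum over all families of copies. *)
pose F i u := if X u == X (w i) then cond_kernel v u else 0.
have -> : \prod_i (Prob_eq P (fun w => (X w, Y w)) (X (w i), Y v)
      / Prob_eq P Y (Y v)) = \prod_i \sum_u F i u.
  apply: eq_bigr => i _; rewrite {1}/Prob_eq big_distrl big_mkcond /=.
  apply: eq_bigr => u _; rewrite /F /cond_kernel xpair_eqE.
  by case: eqP.
rewrite bigA_distr_bigA big_distrr /=; apply: eq_bigr => w' _.
have -> : \prod_i cond_kernel v' (w' i) = \prod_i cond_kernel v (w' i).
  by apply: eq_bigr => i _; rewrite /cond_kernel Yv.
rewrite xpair_eqE Yv eqxx andbT; case: eqP => [eqX|neqX].
  congr (_ * _); apply: eq_bigr => i _; rewrite /F.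
  by move/ffunP: eqX => /(_ i); rewrite !ffunE => ->; rewrite eqxx.
have [i neqi] : exists i, X (w' i) != X (w i).
  apply/existsP; apply: contra_notT neqX => /existsPn eqX.
  by apply/ffunP => i; rewrite !ffunE; apply/eqP; rewrite -[_ == _]negbK eqX.
by rewrite (bigD1 i) //= /F (negbTE neqi) mul0r mulr0.
Qed.

(** Chain rule: the logarithm of the product formula, averaged, gives H[Y] plus one term H[X | Y]
    for each copy. *)
Lemma cond_copies_entropy (i0 : I) :
  entropy cond_copies (fun o => ([ffun i => X (o.2 i)], Y o.1)) =
  entropy P Y + #|I|%:R * (entropy P (fun w => (X w, Y w)) - entropy P Y).
Proof.
have lawXY i := @cond_copies_law _ (fun x y => (x, y)) i.
have lawY := @cond_copies_law _ (fun x y => y) i0.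
rewrite -(entropy_same_law lawY) [X in X%:R]cardT -[X in X%:R * _]sum1_size.
rewrite natr_sum big_distrl /= big_enum /=.
under eq_bigr => i _ do rewrite mul1r -(entropy_same_law (lawXY i)).
rewrite !entropyE.
under [X in _ + X]eq_bigr => i _ do rewrite entropyE -sumrB.
rewrite exchange_big -big_split /=; apply: eq_bigr => o _.
under eq_bigr => i _ do rewrite -mulrBr.
rewrite -big_distrr -mulrDr /=.
have [P0|Po] := pmf_gt0_or0 cond_copies o.
  by rewrite (P0 : cond_copies_pmf o = 0) !mul0r.
congr (_ * _).
have Pv : 0 < P o.1.
  have [P0|//] := pmf_gt0_or0 P o.1.
  by move: Po; rewrite /= /cond_copies_pmf P0 mul0r ltxx.
rewrite (cond_copies_joint_prob Pv) lawY.
under [X in _ + X]eq_bigr => i _ do rewrite (lawXY i).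
set pY := Prob_eq P Y _.
have pY0 : 0 < pY by apply: Prob_eq_gt0.
have a0 i : 0 < Prob_eq P (fun w => (X w, Y w)) (X (o.2 i), Y o.1).
  by rewrite -(lawXY i); exact: (Prob_eq_gt0
    (fun o : Om * {ffun I -> Om} => (X (o.2 i), Y o.1)) Po).
have prod0 : 0 < \prod_i (Prob_eq P (fun w => (X w, Y w)) (X (o.2 i), Y o.1) / pY).
  by apply: prodr_gt0 => i _; rewrite divr_gt0.
rewrite lnV ?posrE ?mulr_gt0 // lnM ?posrE // opprD -lnV ?posrE //.
congr (_ + _); rewrite ln_prod => [|i]; last by rewrite divr_gt0.
rewrite -sumrN; apply: eq_bigr => i _.
by rewrite ln_div ?posrE // !lnV ?posrE //; ring.
Qed.

End CondCopies.

(** * Entropies of dilates *)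

(** The bound for a sum of dilates, [dilD], involves four copies. With pairs of booleans a case
    analysis enumerates the indices. *)
Definition copy_index : finType := (bool * bool)%type.

Section Dilates.
Context {R : realType} {Om : finType} (P : fdist R Om) (X Y : Om -> rat).

Local Notation I := copy_index.
Local Notation i1 := ((false, false) : copy_index).
Local Notation i2 := ((false, true) : copy_index).
Local Notation i3 := ((true, false) : copy_index).
Local Notation i4 := ((true, true) : copy_index).
Local Notation Om4 := (Om * {ffun I -> Om})%type.
Local Notation H := (entropy (cond_copies P I Y)).
Local Notation N := (entropy P (fun w => (X w, Y w))).
Local Notation hY := (entropy P Y).
Local Notation y := (fun o : Om4 => Y o.1).

(* [dil l - N] is the quantity g(l) = H[X_1 - l X_2 | Y] - H[X | Y]. *)
Definition dil (l : rat) : R :=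
  H (fun o : Om4 => (X (o.2 i1) - l * X (o.2 i2), Y o.1)).

Lemma copies_single (T : eqType) (f : rat -> rat -> T) i :
  H (fun o : Om4 => f (X (o.2 i)) (Y o.1)) = entropy P (fun w => f (X w) (Y w)).
Proof. exact/entropy_same_law/cond_copies_law. Qed.

Lemma copies_Y : H y = hY.
Proof. exact: (copies_single (fun _ y => y) i1). Qed.

Lemma copies_XY i : H (fun o : Om4 => (X (o.2 i), Y o.1)) = N.
Proof. exact: (copies_single (fun x y => (x, y)) i). Qed.

Lemma dilE i j l : i != j ->
  H (fun o : Om4 => (X (o.2 i) - l * X (o.2 j), Y o.1)) = dil l.
Proof.
move=> ij; pose s (k : I) := tperm (tperm i1 i i2) j (tperm i1 i k).
have s_bij : bijective s. by apply: injF_bij => a b /perm_inj /perm_inj.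
have s1 : s i1 = i.
  rewrite /s tpermL tpermD //; last by rewrite eq_sym.
  by rewrite -[X in _ != X](tpermL i1 i) (inj_eq perm_inj).
have s2 : s i2 = j by rewrite /s tpermL.
rewrite -[in LHS]s1 -[in LHS]s2.
exact/entropy_same_law/(cond_copies_perm P Y
  (fun (u : I -> Om) v => (X (u i1) - l * X (u i2), Y v)) s_bij).
Qed.

Lemma pair_le i j : H (fun o : Om4 => (X (o.2 i), X (o.2 j), Y o.1)) <= 2 * N - hY.
Proof.
suff : hY + H (fun o : Om4 => (X (o.2 i), X (o.2 j), Y o.1)) <= N + N by lra.
rewrite -copies_Y -[X in X + N](copies_XY i) -[X in _ <= _ + X](copies_XY j).
by apply: entropy_submod => [w v [_ ->]|w v [_ ->]|w v [-> ->] [->]].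
Qed.

Lemma four_ge (T : eqType) (W : Om4 -> T) :
  (forall w v, W w = W v -> (forall i, X (w.2 i) = X (v.2 i)) /\ Y w.1 = Y v.1) ->
  4 * N - 3 * hY <= H W.
Proof.
move=> detW.
have := cond_copies_entropy P X Y i1; rewrite card_prod card_bool => E.
have -> : 4 * N - 3 * hY = hY + (2 * 2)%:R * (N - hY) by ring.
rewrite -E; apply: entropy_mono => w v /detW[eX ->]; congr (_, _).
by apply/ffunP => i; rewrite !ffunE eX.
Qed.

(** Adjoining the missing copy to [W] reaches the case of four copies, and by submodularity over [Y]
    this costs at most H[X | Y]. The same step leads on to [two_ge]. *)
Lemma three_ge (T : eqType) (W : Om4 -> T) i :
  (forall w v, W w = W v ->
     (forall j, j != i -> X (w.2 j) = X (v.2 j)) /\ Y w.1 = Y v.1) ->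
  3 * N - 2 * hY <= H W.
Proof.
move=> detW.
have four : 4 * N - 3 * hY <= H (fun o => (W o, (X (o.2 i), Y o.1))).
  apply: four_ge => w v [/detW[eX _] ei ->]; split=> // j.
  by have [->|/eX] := eqVneq j i.
have : H y + H (fun o => (W o, (X (o.2 i), Y o.1))) <=
    H W + H (fun o : Om4 => (X (o.2 i), Y o.1)).
  by apply: entropy_submod => [w v /detW[]|w v []|w v -> [-> ->]].
by rewrite copies_Y copies_XY; lra.
Qed.

Lemma two_ge (T : eqType) (W : Om4 -> T) i j :
  (forall w v, W w = W v ->
     (forall k, k != i -> k != j -> X (w.2 k) = X (v.2 k)) /\ Y w.1 = Y v.1) ->
  2 * N - hY <= H W.
Proof.
move=> detW.
have three : 3 * N - 2 * hY <= H (fun o => (W o, (X (o.2 i), Y o.1))).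
  apply: (@three_ge _ _ j) => w v [/detW[eX _] ei ->]; split=> // k kj.
  by have [->|ki] := eqVneq k i; [|exact: eX].
have : H y + H (fun o => (W o, (X (o.2 i), Y o.1))) <=
    H W + H (fun o : Om4 => (X (o.2 i), Y o.1)).
  by apply: entropy_submod => [w v /detW[]|w v []|w v -> [-> ->]].
by rewrite copies_Y copies_XY; lra.
Qed.

Lemma dil0 : dil 0 = N.
Proof.
rewrite -(copies_XY i1); apply: entropy_eq_ker => w v.
by rewrite !mul0r !subr0.
Qed.

Lemma dil_ge l : N <= dil l.
Proof.
have two : 2 * N - hY <= H (fun o : Om4 => (X (o.2 i1), X (o.2 i2), Y o.1)).
  by apply: (@two_ge _ _ i3 i4) => w v [e1 e2 ->]; split=> // -[[] []].
have : H y + H (fun o : Om4 => (X (o.2 i1), X (o.2 i2), Y o.1)) <=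
    dil l + H (fun o : Om4 => (X (o.2 i2), Y o.1)).
  apply: entropy_submod => [w v []//|w v []//|w v [e1 _] [e2 ->]].
  by move: e1; rewrite e2 => /addIr ->.
by rewrite copies_Y copies_XY; lra.
Qed.

(** A Ruzsa triangle inequality. The identity X_1 - lm X_3 = (X_1 - l X_2) + l (X_2 - m X_3) makes
    the left side a function of [A] and of [B], and for l nonzero [A] and [B] together determine
    X_1, X_2, X_3 and Y. *)
Lemma dilM l m : dil (l * m) + N <= dil l + dil m.
Proof.
have [->|l0] := eqVneq l 0; first by rewrite mul0r dil0; have := dil_ge m; lra.
pose A (o : Om4) := (X (o.2 i1), X (o.2 i3), Y o.1).
pose B (o : Om4) := ((X (o.2 i1) - l * X (o.2 i2), Y o.1),
                     (X (o.2 i2) - m * X (o.2 i3), Y o.1)).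
pose W (o : Om4) := (X (o.2 i1), X (o.2 i2), X (o.2 i3), Y o.1).
have HA : H A <= 2 * N - hY by apply: pair_le.
have HB : hY + H B <= dil l + dil m.
  rewrite -copies_Y -(@dilE i2 i3 m) // /B.
  by apply: entropy_submod => [w v []|w v []|w v -> ->].
have HW : 3 * N - 2 * hY <= H W.
  by apply: (@three_ge _ _ i4) => w v [e1 e2 e3 ->]; split=> // -[[] []].
have : dil (l * m) + H W <= H A + H B.
  rewrite -(@dilE i1 i3 (l * m)) // /W.
  apply: entropy_submod => [w v [-> -> ->] //|w v [e1 ey e2 _]|w v [e1 e3 ->] [e2 _ _ _]].
    congr (_, _) => //.
    have e (o : Om4) : X (o.2 i1) - l * m * X (o.2 i3) =
      (X (o.2 i1) - l * X (o.2 i2)) + l * (X (o.2 i2) - m * X (o.2 i3)) by ring.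
    by rewrite !e e1 e2.
  congr (_, _, _, _) => //; apply: (mulfI l0).
  by move: e2; rewrite e1; lra.
by lra.
Qed.

(** The three-term combination is a function of (X_1 - l X_3, X_4, Y) and of (X_1 - m X_4, X_3, Y),
    which jointly determine all three copies. *)
Lemma three_sum_le l m :
  H (fun o : Om4 => (X (o.2 i1) - l * X (o.2 i3) - m * X (o.2 i4), Y o.1)) + N
  <= dil l + dil m.
Proof.
pose A (o : Om4) := ((X (o.2 i1) - l * X (o.2 i3), Y o.1), (X (o.2 i4), Y o.1)).
pose B (o : Om4) := ((X (o.2 i1) - m * X (o.2 i4), Y o.1), (X (o.2 i3), Y o.1)).
pose W (o : Om4) := (X (o.2 i1), X (o.2 i3), X (o.2 i4), Y o.1).
have HA : hY + H A <= dil l + N.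
  rewrite -copies_Y -(@dilE i1 i3 l) // -[X in _ <= _ + X](copies_XY i4) /A.
  by apply: entropy_submod => [w v []|w v []|w v -> ->].
have HB : hY + H B <= dil m + N.
  rewrite -copies_Y -(@dilE i1 i4 m) // -[X in _ <= _ + X](copies_XY i3) /B.
  by apply: entropy_submod => [w v []|w v []|w v -> ->].
have HW : 3 * N - 2 * hY <= H W.
  by apply: (@three_ge _ _ i2) => w v [e1 e2 e3 ->]; split=> // -[[] []].
have : H (fun o : Om4 => (X (o.2 i1) - l * X (o.2 i3) - m * X (o.2 i4), Y o.1))
    + H W <= H A + H B.
  apply: entropy_submod => [w v [-> -> -> //]|w v [e1 -> -> _]|w v].
    by rewrite addrAC e1 addrAC.
  move=> [e1 ey e4 _] [_ _ e3 _]; rewrite /W e4 e3 ey; congr (_, _, _, _).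
  by move: e1; rewrite e3 => /addIr.
by lra.
Qed.

(** Here X_1 - (l + m) X_2 equals (X_1 - l X_3 - m X_4) - l (X_2 - X_3) - m (X_2 - X_4); each of the
    last two differences costs one [dil 1]. Submodularity is applied to this triple and (X_1, X_2,
    Y). *)
Lemma dilD l m : dil (l + m) + 3 * N <= dil l + dil m + 2 * dil 1.
Proof.
pose V (o : Om4) := (X (o.2 i1) - l * X (o.2 i3) - m * X (o.2 i4), Y o.1).
pose D3 (o : Om4) := (X (o.2 i2) - 1 * X (o.2 i3), Y o.1).
pose D4 (o : Om4) := (X (o.2 i2) - 1 * X (o.2 i4), Y o.1).
pose A (o : Om4) := (X (o.2 i1), X (o.2 i2), Y o.1).
pose B (o : Om4) := (V o, (D3 o, D4 o)).
have HA : H A <= 2 * N - hY by apply: pair_le.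
have HV : H V + N <= dil l + dil m by apply: three_sum_le.
have HD3 : H D3 = dil 1 by apply: dilE.
have HD4 : H D4 = dil 1 by apply: dilE.
have HD : hY + H (fun o => (D3 o, D4 o)) <= H D3 + H D4.
  rewrite -copies_Y /D3 /D4.
  by apply: entropy_submod => [w v []|w v []|w v -> ->].
have HB : hY + H B <= H V + H (fun o => (D3 o, D4 o)).
  rewrite -copies_Y /B.
  by apply: entropy_submod => [w v []|w v [_ -> _ _]|w v -> ->].
have HW : 4 * N - 3 * hY <= H (fun o => (A o, B o)).
  apply: four_ge => w v [e1 e2 -> _ _ e3 _ e4 _].
  by split=> // -[[] []] //; move: e3 e4; rewrite ?e2; lra.
have : dil (l + m) + H (fun o => (A o, B o)) <= H A + H B.
  apply: entropy_submod => [w v [-> -> ->] //|w v [eV -> e3 _ e4 _]|w v -> -> //].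
  congr (_, _).
  have e (o : Om4) : X (o.2 i1) - (l + m) * X (o.2 i2) =
    (X (o.2 i1) - l * X (o.2 i3) - m * X (o.2 i4))
    - l * (X (o.2 i2) - 1 * X (o.2 i3)) - m * (X (o.2 i2) - 1 * X (o.2 i4)) by ring.
  by rewrite !e eV e3 e4.
by lra.
Qed.

(** The sum X_3 + X_4 is traded for X_1 - X_3 - X_4, which together with X_1 determines it and which
    [three_sum_le] controls at l = m = 1. *)
Lemma dilN1 : dil (-1) + N <= 2 * dil 1.
Proof.
pose S (o : Om4) := (X (o.2 i3) - (-1) * X (o.2 i4), Y o.1).
pose S1 (o : Om4) := (S o, (X (o.2 i1), Y o.1)).
pose S3 (o : Om4) := (S o, (X (o.2 i3), Y o.1)).
pose T (o : Om4) := (X (o.2 i1) - 1 * X (o.2 i3) - 1 * X (o.2 i4), Y o.1).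
have HS : H S = dil (-1) by apply: dilE.
have HT : H T + N <= dil 1 + dil 1 by apply: three_sum_le.
have HS1 : hY + H S1 <= H T + N.
  rewrite -copies_Y -(copies_XY i1).
  apply: entropy_submod => [w v []|w v []|w v [e1 ey] [e2 _]] //.
  by rewrite /S1 /S e2 ey; congr ((_, _), _); move: e1; rewrite e2; lra.
have HS3 : H S3 <= 2 * N - hY.
  apply: le_trans (pair_le i3 i4); apply: entropy_mono => w v.
  by rewrite /S3 /S => -[-> -> ->].
have HW : 3 * N - 2 * hY <= H (fun o => (S1 o, S3 o)).
  apply: (@three_ge _ _ i2) => w v [eS ey e1 _ _ _ e3 _].
  by split=> // -[[] []] //; move: eS; rewrite e3; lra.
have : H S + H (fun o => (S1 o, S3 o)) <= H S1 + H S3.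
  rewrite /S1 /S3 /S.
  by apply: entropy_submod => [w v [-> -> _ _] //|w v [-> -> _ _] //|w v -> -> //].
by lra.
Qed.

Lemma dilV l : l != 0 -> dil l^-1 = dil l.
Proof.
move=> l0; rewrite -(@dilE i2 i1 l) //; apply: entropy_eq_ker => w v.
have e (o : Om4) : X (o.2 i2) - l * X (o.2 i1) =
  - l * (X (o.2 i1) - l^-1 * X (o.2 i2)) by field.
rewrite !e; split=> -[e1 ->]; first by congr (_, _); apply: mulfI e1; rewrite oppr_eq0.
by rewrite e1.
Qed.

End Dilates.

(** * Dilates by slopes and by polynomials in slopes *)

Section Projections.
Context {R : realType} {Om : finType} (P : fdist R Om) (X Y : Om -> rat) (M : R).

Local Notation I := copy_index.
Local Notation i1 := ((false, false) : copy_index).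
Local Notation i2 := ((false, true) : copy_index).
Local Notation i3 := ((true, false) : copy_index).
Local Notation i4 := ((true, true) : copy_index).
Local Notation Om4 := (Om * {ffun I -> Om})%type.
Local Notation H := (entropy (cond_copies P I Y)).
Local Notation N := (entropy P (fun w => (X w, Y w))).

Lemma joint_le : entropy P X <= M -> entropy P Y <= M -> N <= 2 * M.
Proof.
move=> HX HY.
have : N <= entropy P X + entropy P Y by apply: entropy_subadd => w v -> ->.
by lra.
Qed.

Lemma proj_le_joint s : entropy P (fun w => X w + s * Y w) <= N.
Proof. by apply: entropy_mono => w v [-> ->]. Qed.

Local Notation W := (fun o : Om4 => (X (o.2 i1), X (o.2 i2), Y o.1)).

Lemma copies_triple_ge : entropy P Y <= M -> 2 * N - M <= H W.
Proof.
move=> HY; suff : 2 * N - entropy P Y <= H W by lra.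
by apply: (@two_ge _ _ _ _ _ _ _ i3 i4) => w v [e1 e2 ->]; split=> // -[[] []].
Qed.

Lemma copies_pair_le : entropy P X <= M ->
  H (fun o : Om4 => (X (o.2 i1), X (o.2 i2))) <= 2 * M.
Proof.
move=> HX.
have : H (fun o : Om4 => (X (o.2 i1), X (o.2 i2))) <=
    H (fun o : Om4 => X (o.2 i1)) + H (fun o : Om4 => X (o.2 i2)).
  by apply: entropy_subadd => w v -> ->.
rewrite (copies_single P X Y (fun x y => x) i1).
by rewrite (copies_single P X Y (fun x y => x) i2); lra.
Qed.

Lemma copies_sum_le : entropy P (fun w => X w + Y w) <= M ->
  H (fun o : Om4 => X (o.2 i2) + Y o.1) <= M.
Proof. by rewrite (copies_single P X Y (fun x y => x + y) i2). Qed.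

(** X_1 - r X_2 = (X_1 + rY) - r (X_2 + Y) is a function of (X_1, X_2) and of a pair of entropy at
    most 2M. Together these determine X_1, X_2 and Y. Adjoining Y to the difference costs at most M
    more. *)
Lemma dil_slope_le r : entropy P X <= M -> entropy P Y <= M ->
  entropy P (fun w => X w + Y w) <= M -> entropy P (fun w => X w + r * Y w) <= M ->
  dil P X Y r - N <= 3 * (2 * M - N).
Proof.
move=> HX HY /copies_sum_le HXY Hr.
have HX12 := copies_pair_le HX; have HW := copies_triple_ge HY.
have Hr1 : H (fun o : Om4 => X (o.2 i1) + r * Y o.1) <= M.
  by rewrite (copies_single P X Y (fun x y => x + r * y) i1).
pose B (o : Om4) := (X (o.2 i1) + r * Y o.1, X (o.2 i2) + Y o.1).
pose D (o : Om4) := X (o.2 i1) - r * X (o.2 i2).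
have HB : H B <= M + M.
  apply: le_trans (_ : _ <= H (fun o : Om4 => X (o.2 i1) + r * Y o.1) +
    H (fun o : Om4 => X (o.2 i2) + Y o.1)) _; last by rewrite lerD.
  by rewrite /B; apply: entropy_subadd => w v -> ->.
have HD : H D + H W <= H (fun o : Om4 => (X (o.2 i1), X (o.2 i2))) + H B.
  rewrite /D /B; apply: entropy_submod => [w v [-> ->] //|w v [e1 e2]|w v [-> ->] [_]].
    have e (o : Om4) : X (o.2 i1) - r * X (o.2 i2) =
      (X (o.2 i1) + r * Y o.1) - r * (X (o.2 i2) + Y o.1) by ring.
    by rewrite !e e1 e2.
  by move=> /addrI ->.
have : dil P X Y r <= H D + entropy P Y.
  rewrite -(copies_Y P X Y) /dil /D.
  by apply: entropy_subadd => w v -> ->.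
by lra.
Qed.

(** The converse passage: X_1 + sY = (X_1 - s X_2) + s (X_2 + Y). One use of submodularity bounds
    the entropy of X_1 - s X_2 by that of its dilate paired with Y, a second one bounds X_1 + sY. *)
Lemma proj_le_dil s : entropy P X <= M -> entropy P Y <= M ->
  entropy P (fun w => X w + Y w) <= M ->
  entropy P (fun w => X w + s * Y w) <=
  M + 2 * (2 * M - N) + (dil P X Y s - N).
Proof.
move=> HX HY /copies_sum_le HXY.
have HX12 := copies_pair_le HX; have HW := copies_triple_ge HY.
pose D (o : Om4) := X (o.2 i1) - s * X (o.2 i2).
pose A (o : Om4) := (X (o.2 i1), Y o.1).
pose B (o : Om4) := (D o, X (o.2 i2) + Y o.1).
have HD : H D + H W <= H (fun o : Om4 => (X (o.2 i1), X (o.2 i2))) + dil P X Y s.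
  rewrite /D /dil; apply: entropy_submod => [w v|w v|w v]; first by case=> -> ->.
    by case.
  by move=> eA; case=> _ ey; move: eA; case=> -> ->; rewrite ey.
have HB : H B <= H D + M.
  apply: le_trans (_ : _ <= H D + H (fun o : Om4 => X (o.2 i2) + Y o.1)) _;
    last by rewrite lerD2l.
  by rewrite /B; apply: entropy_subadd => w v -> ->.
have : H (fun o : Om4 => X (o.2 i1) + s * Y o.1) + H W <= H A + H B.
  rewrite /A /B; apply: entropy_submod =>
    [w v [-> ->] //|w v [e1 e2]|w v [-> ->] [_ /addIr ->] //].
  have e (o : Om4) : X (o.2 i1) + s * Y o.1 =
    D o + s * (X (o.2 i2) + Y o.1) by rewrite /D; ring.
  by rewrite !e e1 e2.
rewrite (copies_single P X Y (fun x y => x + s * y) i1).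
rewrite (copies_XY P X Y i1).
by lra.
Qed.

End Projections.

Section Slopes.
Context {R : realType} (g : rat -> R) (K : R).
Hypothesis (g_ge0 : forall l, 0 <= g l) (g0 : g 0 = 0) (g1 : g 1 <= K)
  (gN1 : g (-1) <= 2 * K) (gM : forall l m, g (l * m) <= g l + g m)
  (gD : forall l m, g (l + m) <= g l + g m + 2 * K).

Let K0 : 0 <= K. Proof. exact: le_trans g1. Qed.

(** Induction on binary digits: a digit costs 4K for doubling, K for its own value and 2K for the
    addition. *)
Lemma slope_nat_le D n : (n < 2 ^ D)%N -> g n%:R <= 7 * D%:R * K.
Proof.
elim: D n => [|D IH] n.
  by rewrite expn0 ltnS leqn0 => /eqP ->; rewrite g0 mulr0 mul0r.
move=> nD; have half : g (n./2)%:R <= 7 * D%:R * K.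
  by apply: IH; rewrite -(ltn_pmul2l (isT : 0 < 2)%N) -expnS mul2n (leq_ltn_trans _ nD) //
    -{2}(odd_double_half n) leq_addl.
have g2 : g 2 <= 4 * K by have := gD 1 1; move: g1; rewrite -[1 + 1]/2%:R; lra.
have dbl : g (2 * (n./2)%:R) <= 4 * K + 7 * D%:R * K.
  by have := gM 2 (n./2)%:R; lra.
have En : n%:R = (odd n)%:R + 2 * (n./2)%:R :> rat.
  by rewrite -[in LHS](odd_double_half n) natrD -mul2n natrM.
have Eb : g (odd n)%:R <= K by case: (odd n); rewrite ?g0.
rewrite En; apply: le_trans (gD _ _) _.
by rewrite -(natr1 D); lra.
Qed.

(** Since 2^D itself is allowed, D + 1 digits are used; the sign adds at most 2K. *)
Lemma slope_int_le D (c : int) : `|c| <= 2 ^+ D -> g c%:~R <= 9 * D.+1%:R * K.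
Proof.
have nat_case n : (n <= 2 ^ D)%N -> g n%:R <= 7 * D.+1%:R * K.
  by move=> nD; apply: slope_nat_le; apply: (leq_ltn_trans nD); rewrite ltn_exp2l.
have DK : K <= D.+1%:R * K by rewrite ler_peMl // ler1n.
have bound n : `|n%:Z| <= 2 ^+ D -> (n <= 2 ^ D)%N.
  by rewrite -abszE -natz -[2]/(2%:R) -natrX ler_nat.
case: c => n.
  move/bound/nat_case; rewrite -pmulrn; have := K0; nra.
rewrite NegzE normrN => /bound/nat_case; have := gM (-1) n.+1%:R; move: gN1.
by rewrite mulN1r -[(- _)%:~R]/(- n.+1%:R); lra.
Qed.

(** A polynomial in nested form, one variable at a time, with coefficients indexed by lists of
    exponents. Each single exponent is at most [D], a box that contains all monomials of total
    degree at most [D]. *)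
Fixpoint nested_eval (D : nat) (rs : seq rat) (c : seq nat -> int) : rat :=
  if rs is r :: rs' then
    \sum_(j < D.+1) r ^+ j * nested_eval D rs' (fun t => c (nat_of_ord j :: t))
  else (c [::])%:~R.

(** A Horner step costs B for the coefficient, K for multiplying by [r] and 2K for the addition. *)
Lemma slope_horner_le r B n (a : nat -> rat) : g r <= K -> (forall j, g (a j) <= B) ->
  g (\sum_(j < n) r ^+ j * a j) <= n%:R * (B + 3 * K).
Proof.
move=> gr; elim: n a => [|n IH] a aB; first by rewrite big_ord0 g0 mul0r.
rewrite big_ord_recl expr0 mul1r.
have -> : \sum_(i < n) r ^+ lift ord0 i * a (lift ord0 i) =
    r * \sum_(i < n) r ^+ i * a i.+1.
  by rewrite big_distrr; apply: eq_bigr => i _ /=; rewrite exprS mulrA.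
have := gD (a 0%N) (r * \sum_(i < n) r ^+ i * a i.+1).
have := gM r (\sum_(i < n) r ^+ i * a i.+1).
have := IH (fun j => a j.+1) (fun j => aB _); have := aB 0%N.
by rewrite /= -(natr1 n); lra.
Qed.

(** The digits of the coefficients give one factor D + 1 and each variable gives another, whence the
    exponent k + 1. *)
Lemma slope_nested_le D rs c : (forall r, r \in (rs : seq rat) -> g r <= K) ->
  (forall t, `|c t| <= 2 ^+ D) ->
  g (nested_eval D rs c) <= (9 + 3 * (size rs)%:R) * D.+1%:R ^+ (size rs).+1 * K.
Proof.
elim: rs c => [|r rs IH] c grs cD.
  by rewrite /= mulr0 addr0 expr1; apply: slope_int_le.
set B := (9 + 3 * (size rs)%:R) * D.+1%:R ^+ (size rs).+1 * K.
have gr : g r <= K by apply: grs; rewrite mem_head.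
have aB j : g (nested_eval D rs (fun t => c (j :: t))) <= B.
  by apply: IH => // r' r'rs; apply: grs; rewrite in_cons r'rs orbT.
apply: le_trans (slope_horner_le D.+1 gr aB) _.
rewrite [size _]/= [X in _ <= _ * X * _]exprS.
have K_le : K <= D.+1%:R ^+ (size rs).+1 * K by rewrite ler_peMl // exprn_ege1 // ler1n.
have -> : (9 + 3 * (size rs).+1%:R) * (D.+1%:R * D.+1%:R ^+ (size rs).+1) * K =
    D.+1%:R * (B + 3 * (D.+1%:R ^+ (size rs).+1 * K)).
  by rewrite /B -(natr1 (size rs)); ring.
by rewrite ler_pM2l ?ltr0n //; lra.
Qed.

End Slopes.

(** * The upper bound *)

Section PolynomialEval.

Fixpoint exponents (D n : nat) : seq (seq nat) :=
  if n is n'.+1 then [seq j :: t | j <- iota 0 D.+1, t <- exponents D n']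
  else [:: [::]].

Lemma mem_exponents D n t :
  (t \in exponents D n) = (size t == n) && all (leq^~ D) t.
Proof.
elim: n t => [|n IH] t; first by rewrite inE; case: t.
rewrite -/([seq j :: t | j <- iota 0 D.+1, t <- exponents D n]).
case: t => [|j t]; first by apply/negbTE/allpairsP => -[[? ?] []].
apply/allpairsP/idP => [[[i u] /= [iD uD [-> ->]]]|/and3P[st jD tD]].
  rewrite eqSS; move: uD; rewrite IH => /andP[-> ->].
  by move: iD; rewrite (mem_iota 0 D.+1) add0n ltnS andbT.
exists (j, t); split=> //=; last by rewrite IH; apply/andP.
by rewrite (mem_iota 0 D.+1) add0n ltnS.
Qed.

Lemma exponents_uniq D n : uniq (exponents D n).
Proof.
elim: n => [//|n IH]; rewrite allpairs_uniq ?iota_uniq //.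
by move=> [i t] [j u] _ _ [-> ->].
Qed.

Lemma nested_evalE D rs c : nested_eval D rs c =
  \sum_(t <- exponents D (size rs))
     (c t)%:~R * \prod_(i < size rs) rs`_i ^+ nth 0%N t i.
Proof.
elim: rs c => [|r rs IH] c; first by rewrite /= big_seq1 big_ord0 mulr1.
rewrite [LHS]/= -[exponents D (size (r :: rs))]
  /([seq j :: t | j <- iota 0 D.+1, t <- exponents D (size rs)]).
rewrite big_allpairs_dep -[iota 0 D.+1]/(index_iota 0 D.+1) big_mkord.
apply: eq_bigr => j _; rewrite IH big_distrr /=; apply: eq_bigr => t _.
by rewrite big_ord_recl /= mulrCA.
Qed.

Lemma rat_eval_nested (rs : seq rat) D (p : mpoly.mpoly (size rs) int) :
  small_poly D p ->
  exists2 c, (forall t, `|c t| <= 2 ^+ D) & rat_eval p = nested_eval D rs c.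
Proof.
move=> [szp cp]; set n := size rs in p szp cp *.
pose mon (t : seq nat) : mpoly.multinom n := mpoly.Multinom [tuple nth 0%N t i | i < n].
exists (fun t => mpoly.mcoeff (mon t) p) => [t|]; first exact: cp.
pose exps (m : mpoly.multinom n) : seq nat := tval (mpoly.multinom_val m).
have expsK : cancel exps mon.
  move=> m; apply/mpoly.mnmP => i; rewrite /mon mpoly.mnmE.
  by rewrite -mpoly.mnm_nth.
have monK t : size t = n -> exps (mon t) = t.
  move=> st; apply: (@eq_from_nth _ 0%N) => [|i]; rewrite size_tuple ?st // => ltin.
  by rewrite -[i]/(nat_of_ord (Ordinal ltin)) -mpoly.mnm_nth mpoly.mnmE.
have supp_exps m : m \in mpoly.msupp p -> exps m \in exponents D n.
  move=> /mpoly.msize_mdeg_lt mD; rewrite mem_exponents size_tuple eqxx /=.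
  have {}mD : (mpoly.mdeg m <= D)%N by rewrite -ltnS (leq_trans mD).
  apply/(all_nthP 0%N) => i; rewrite size_tuple => ltin.
  apply: leq_trans mD; rewrite mpoly.mdegE (bigD1 (Ordinal ltin)) //=.
  by rewrite (mpoly.mnm_nth 0%N) leq_addr.
rewrite nested_evalE -/n /rat_eval /mpoly.mmap.
rewrite [RHS](bigID (fun t => t \in map exps (mpoly.msupp p))) /=.
rewrite [X in _ + X]big1_seq ?addr0 => [|t /andP[tp]]; last first.
  rewrite mem_exponents => /andP[/eqP st _].
  have -> : mpoly.mcoeff (mon t) p = 0.
    apply/mpoly.memN_msupp_eq0; apply: contraNN tp => tp.
    by rewrite -(monK t st) map_f.
  by rewrite mul0r.
rewrite -[RHS]big_filter.
(* Exponent lists outside the support have coefficient 0, so the sum over the box reduces to the sum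
   over the support. *)
have perm_supp : perm_eq [seq t <- exponents D n | t \in map exps (mpoly.msupp p)]
    (map exps (mpoly.msupp p)).
  apply: uniq_perm; first by rewrite filter_uniq ?exponents_uniq.
    by rewrite map_inj_uniq ?mpoly.msupp_uniq //; apply: can_inj expsK.
  move=> t; rewrite mem_filter andb_idr // => /mapP[m mp ->].
  exact: supp_exps.
rewrite (perm_big _ perm_supp) [RHS]big_map /=.
apply: eq_bigr => m _; rewrite expsK; congr (_ * _).
by rewrite /mpoly.mmap1; apply: eq_bigr => i _; rewrite (mpoly.mnm_nth 0%N).
Qed.

End PolynomialEval.

Lemma size_other_slopes (S : {fset slope}) k :
  (base_slopes `<=` S)%fset -> #|` S|%fset = (k + 3)%N -> size (other_slopes S) = k.
Proof.
move=> baseS cardS; rewrite /other_slopes size_pmap.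
(* Infinity is a base slope, so [pmap id] discards nothing. *)
have allS r : r \in enum_fset (S `\` base_slopes)%fset -> r.
  by rewrite in_fsetD !inE !negb_or; case: r => //; rewrite eqxx andbF.
rewrite (@eq_in_count _ _ predT) => [|r /allS ->//].
rewrite count_predT -/(#|` (S `\` base_slopes)%fset|) cardfsD.
have -> : (S `&` base_slopes)%fset = base_slopes by apply/fsetIidPr.
rewrite cardS; have -> : #|` base_slopes|%fset = 3%N; last by rewrite addnK.
rewrite /base_slopes cardfsU cardfs2 cardfs1 fsetI1.
by case: ifP => [|_]; rewrite ?inE // cardfs0.
Qed.

Lemma other_slopes_mem (S : {fset slope}) r : r \in other_slopes S -> Some r \in S.
Proof.
rewrite /other_slopes -[r \in _](mem_map (@Some_inj _)) => /mapP[q].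
rewrite mem_pmap => /mapP[[a|] //]; rewrite in_fsetD => /andP[_ aS] [->] [->] //.
Qed.

Section UpperBound.
Context {R : realType}.

Lemma proj_entropy_le_max (S : {fset slope}) (Om : finType) (P : fdist R Om)
    (X Y : Om -> rat) r :
  r \in S -> proj_entropy P X Y r <= max_proj_entropy S P X Y.
Proof. by move=> rS; rewrite /max_proj_entropy; apply: le_bigmax_seq. Qed.

Lemma dil_complexity_le (Om : finType) (P : fdist R Om) (X Y : Om -> rat) (K : R)
    (rs : seq rat) (s : rat) (D : nat) :
  let N := entropy P (fun w => (X w, Y w)) in
  dil P X Y 1 - N <= K -> (forall r, r \in rs -> dil P X Y r - N <= K) ->
  s != 0 -> rational_expr rs s D ->
  dil P X Y s - N <= 2 * ((9 + 3 * (size rs)%:R) * D.+1%:R ^+ (size rs).+1 * K).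
Proof.
move=> N d1 drs s0 [p [q [sp sq q0 def_s]]].
pose g l := dil P X Y l - N.
have g_ge0 l : 0 <= g l by rewrite subr_ge0 dil_ge.
have g0 : g 0 = 0 by rewrite /g dil0 subrr.
have gN1 : g (-1) <= 2 * K by rewrite /g; have := dilN1 P X Y; rewrite -/N; lra.
have gM l m : g (l * m) <= g l + g m.
  by rewrite /g; have := dilM P X Y l m; rewrite -/N; lra.
have gD l m : g (l + m) <= g l + g m + 2 * K.
  by rewrite /g; have := dilD P X Y l m; rewrite -/N; lra.
have bound (p' : mpoly.mpoly (size rs) int) : small_poly D p' ->
    g (rat_eval p') <= (9 + 3 * (size rs)%:R) * D.+1%:R ^+ (size rs).+1 * K.
  move=> /rat_eval_nested[c cD ->].
  exact: (slope_nested_le g_ge0 g0 d1 gN1 gM gD).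
have gV : g (rat_eval q)^-1 = g (rat_eval q) by rewrite /g dilV.
rewrite -/(g s) def_s; apply: le_trans (gM _ _) _; rewrite gV.
by have := bound p sp; have := bound q sq; lra.
Qed.

Lemma SD_upper (k : nat) : exists2 c : R, 0 < c &
  forall (S : {fset slope}) (s : slope),
    (base_slopes `<=` S)%fset -> #|` S|%fset = (k + 3)%N -> s \notin S ->
    (SD R S s <= (2 - c / (maxn 1 (rational_complexity S s))%:R ^+ k.+1)%:E)%E.
Proof.
(* The 6 is 2 (numerator and denominator) times 3 (from 3 eta), the power of 2 absorbs D + 1 <= 2D,
   and the last 2 is the term 2 eta in the bound for X + sY. *)
pose C : R := 6 * (9 + 3 * k%:R) * 2 ^+ k.+1 + 2.
have C0 : 0 < C.
  by rewrite /C ltr_wpDl // !mulr_ge0 ?exprn_ge0 // addr_ge0 // mulr_ge0.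
exists (C + 1)^-1; first by rewrite invr_gt0 addr_gt0.
move=> S [s|] baseS cardS sS; last first.
  by move: sS; rewrite (fsubsetP baseS) // !inE eqxx !orbT.
set D : R := (maxn _ _)%:R.
have S0 : Some 0 \in S by rewrite (fsubsetP baseS) // !inE eqxx.
have S1 : Some 1 \in S by rewrite (fsubsetP baseS) // !inE eqxx ?orbT.
have Soo : None \in S by rewrite (fsubsetP baseS) // !inE eqxx ?orbT.
have s0 : s != 0 by apply: contraNneq sS => ->.
apply: ereal_inf_lbound; exists (2 - (C + 1)^-1 / D ^+ k.+1) => //.
move=> Om P X Y /=; set M := max_proj_entropy S P X Y.
have HM r : r \in S -> proj_entropy P X Y r <= M by apply: proj_entropy_le_max.
set N := entropy P (fun w => (X w, Y w)).
have HX : entropy P X <= M.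
  apply: le_trans (HM _ S0); rewrite /proj_entropy /=.
  by apply: entropy_mono => w v; rewrite !mul0r !addr0.
have HY : entropy P Y <= M by exact: (HM _ Soo).
have HXY : entropy P (fun w => X w + Y w) <= M.
  apply: le_trans (HM _ S1); rewrite /proj_entropy /=.
  by apply: entropy_mono => w v; rewrite !mul1r.
have M0 : 0 <= M by apply: le_trans HX; apply: entropy_ge0.
have N2 : N <= 2 * M by apply: joint_le.
pose K := 3 * (2 * M - N).
have K0 : 0 <= K by rewrite /K; lra.
set rs := other_slopes S.
have szrs : size rs = k by apply: size_other_slopes.
pose D0 := rational_complexity S (Some s).
have exprs : rational_expr rs s D0.
  by rewrite /D0 /=; case: ex_minnP => m /asboolP.
have d1 : dil P X Y 1 - N <= K.
  by apply: dil_slope_le => //; apply: (HM _ S1).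
have drs r : r \in rs -> dil P X Y r - N <= K.
  by move=> /other_slopes_mem rS; apply: dil_slope_le => //; apply: (HM _ rS).
have := dil_complexity_le d1 drs s0 exprs; rewrite -/N szrs => ds.
have Hs := proj_le_dil s HX HY HXY; have HsN := proj_le_joint P X Y s.
rewrite -/N in Hs HsN; rewrite -/(proj_entropy P X Y (Some s)) in Hs HsN.
set h := proj_entropy _ _ _ _ in Hs HsN *.
set L := D ^+ k.+1.
have D1 : 1 <= D by rewrite /D ler1n leq_max.
have L1 : 1 <= L by apply: exprn_ege1.
have DL : D0.+1%:R ^+ k.+1 <= 2 ^+ k.+1 * L.
  rewrite /L -exprMn lerXn2r ?nnegrE ?mulr_ge0 // ?(le_trans _ D1) //.
  rewrite /D -natrM ler_nat -/D0 mul2n -addnn -addn1 addnC.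
  by rewrite leq_add // leq_max ?leqnn ?orbT.
have dsK : dil P X Y s - N <= (C - 2) * L * (2 * M - N).
  apply: le_trans ds _.
  have -> : (C - 2) * L * (2 * M - N) =
    2 * ((9 + 3 * k%:R) * (2 ^+ k.+1 * L) * K) by rewrite /C /K; ring.
  rewrite ler_pM2l // ler_wpM2r // ler_wpM2l // addr_ge0 // mulr_ge0 //.
have E1 : h <= M + C * L * (2 * M - N).
  have : 2 * (2 * M - N) <= 2 * L * (2 * M - N).
    by rewrite ler_wpM2r ?subr_ge0 // ler_peMr.
  by lra.
have CL0 : 0 < C * L by rewrite mulr_gt0 // (lt_le_trans ltr01).
(* Adding [C * L] times [h <= N] to [E1] eliminates N; moreover (1 + 2t) / (1 + t) = 2 - 1 / (1 +
   t). *)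
have E2 : (1 + C * L) * h <= (1 + 2 * (C * L)) * M.
  have := ler_wpM2l (ltW CL0) HsN; lra.
have E3 : h <= (2 - (1 + C * L)^-1) * M.
  have p0 : 0 < 1 + C * L by rewrite addr_gt0.
  rewrite -(ler_pM2l p0) mulrA mulrBr divff ?gt_eqF //.
  by apply: le_trans E2 _; rewrite le_eqVlt; apply/orP; left; apply/eqP; ring.
apply: le_trans E3 _; rewrite ler_wpM2r // lerD2l lerN2.
rewrite -invfM lef_pV2 ?posrE ?addr_gt0 ?mulr_gt0 ?(lt_le_trans ltr01 L1) ?addr_gt0 //.
by rewrite [leRHS]mulrDl mul1r addrC lerD2l.
Qed.

End UpperBound.

(** * Values of small polynomials *)

Section Grid.
Context (rs : seq rat).
Local Notation n := (size rs).
Local Notation poly := (mpoly.mpoly n int).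

Lemma small_polyP j (p : poly) :
  small_poly j p <->
  (forall m, mpoly.mcoeff m p != 0 -> (mpoly.mdeg m <= j)%N) /\
  (forall m, `|mpoly.mcoeff m p| <= 2 ^+ j).
Proof.
rewrite /small_poly mpoly.msizeE; split=> -[szp cp]; split=> //.
  move=> m; rewrite -mpoly.mcoeff_msupp => mp.
  by move/bigmax_leqP_seq: szp => /(_ m mp isT); rewrite ltnS.
by apply/bigmax_leqP_seq => m mp _; rewrite ltnS szp // -mpoly.mcoeff_msupp.
Qed.

Lemma small_polyB j (p q : poly) :
  small_poly j p -> small_poly j q -> small_poly j.+1 (p - q).
Proof.
move=> /small_polyP[dp cp] /small_polyP[dq cq]; apply/small_polyP; split=> m.
  rewrite mpoly.mcoeffB => pq; apply: leqW.
  have [p0|/dp //] := eqVneq (mpoly.mcoeff m p) 0.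
  by apply: dq; apply: contraNneq pq => q0; rewrite p0 q0 subrr.
rewrite mpoly.mcoeffB exprS mulr_natl mulr2n.
by apply: le_trans (ler_normB _ _) _; apply: lerD.
Qed.

Lemma small_polyN j (p : poly) : small_poly j p -> small_poly j (- p).
Proof.
move=> /small_polyP[dp cp]; apply/small_polyP; split=> m; rewrite mpoly.mcoeffN.
  by rewrite oppr_eq0 => /dp.
by rewrite normrN.
Qed.

Lemma small_polyD j (p q : poly) :
  small_poly j p -> small_poly j q -> small_poly j.+1 (p + q).
Proof. by move=> sp /small_polyN sq; rewrite -[q]opprK; apply: small_polyB. Qed.

(** Multiplying by a variable raises the degree by one and only shifts coefficients, while the
    addition at most doubles them: both fit one level up. *)
Lemma small_poly_addMX j (p q : poly) i :
  small_poly j p -> small_poly j q ->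
  small_poly j.+1 (p + q * mpoly.mpolyX int (mpoly.mnm1 i)).
Proof.
move=> /small_polyP[dp cp] /small_polyP[dq cq].
have supp m : mpoly.mcoeff m (q * mpoly.mpolyX int (mpoly.mnm1 i)) != 0 ->
    exists2 k, m = mpoly.mnm_add (mpoly.mnm1 i) k & mpoly.mcoeff k q != 0.
  rewrite -mpoly.mcoeff_msupp (perm_mem (mpoly.msuppMX _ _)) => /mapP[k].
  by rewrite mpoly.mcoeff_msupp; exists k.
apply/small_polyP; split=> m; rewrite mpoly.mcoeffD.
  have [p0|/dp /leqW //] := eqVneq (mpoly.mcoeff m p) 0.
  rewrite p0 add0r => /supp[k -> /dq kj].
  by rewrite mpoly.mdegD mpoly.mdeg1 add1n ltnS.
rewrite exprS mulr_natl mulr2n; apply: le_trans (ler_normD _ _) _; apply: lerD => //.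
have [->|/supp[k -> _]] := eqVneq (mpoly.mcoeff m (q * mpoly.mpolyX int (mpoly.mnm1 i))) 0.
  by rewrite normr0 exprn_ge0.
by rewrite mpoly.mcoeffMX.
Qed.

Lemma rat_evalB (p q : poly) : rat_eval (p - q) = rat_eval p - rat_eval q.
Proof. exact: mpoly.mmapB. Qed.

Lemma rat_evalD (p q : poly) : rat_eval (p + q) = rat_eval p + rat_eval q.
Proof. exact: mpoly.mmapD. Qed.

Lemma rat_evalMX (q : poly) (i : 'I_n) :
  rat_eval (q * mpoly.mpolyX int (mpoly.mnm1 i)) = rat_eval q * rs`_i.
Proof.
have [mulE _] := mpoly.mmap_is_multiplicative (fun i : 'I_n => rs`_i)
  (intr : {rmorphism int -> rat}).
by rewrite /rat_eval mulE mpoly.mmapX mpoly.mmap1U.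
Qed.

(** Coefficients between -2^j and 2^j are shifted to 0, ..., 2^(j+1), so that small polynomials are
    coded by a finite type of functions that can be counted. *)
Definition grid_coef j (f : {ffun mpoly.bmultinom n j.+1 -> 'I_(2 ^ j.+1).+1}) m : int :=
  (f m)%:Z - 2 ^+ j.

Definition grid_val j (f : {ffun mpoly.bmultinom n j.+1 -> 'I_(2 ^ j.+1).+1}) : rat :=
  \sum_m (grid_coef f m)%:~R * mpoly.mmap1 (fun i : 'I_n => rs`_i) (mpoly.bmnm m).

Definition grid (j : nat) : seq rat := undup (codom (@grid_val j)).

Lemma gridP j x :
  reflect (exists2 p : poly, small_poly j p & rat_eval p = x) (x \in grid j).
Proof.
rewrite mem_undup; apply: (iffP codomP) => [[f ->]|[p [szp cp] <-]].
  pose p : poly := \sum_m grid_coef f m *: mpoly.mpolyX int (mpoly.bmnm m).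
  have coef_le m : `|grid_coef f m| <= 2 ^+ j.
    have f_le : (f m)%:Z <= 2 * 2 ^+ j.
      rewrite -exprS -[2]/(2%:R) -natrX natz lez_nat -ltnS.
      exact: ltn_ord.
    have f_ge0 : 0 <= (f m)%:Z by [].
    by rewrite /grid_coef ler_norml; apply/andP; split; lra.
  have coefE m : mpoly.mcoeff m p = \sum_m' grid_coef f m' * (mpoly.bmnm m' == m)%:R.
    rewrite /p raddf_sum /=; apply: eq_bigr => m' _.
    by rewrite mpoly.mcoeffZ mpoly.mcoeffX.
  have sp : small_poly j p.
    apply/small_polyP; split=> m; rewrite coefE.
      apply: contraR; rewrite -ltnNge => jm; rewrite big1 // => m' _.
      case: eqP => [mm'|_]; last by rewrite mulr0.
      by move: (mpoly.bmdeg m'); rewrite mm' ltnNge jm.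
    case: (ltnP (mpoly.mdeg m) j.+1) => mj.
      rewrite (bigD1 (mpoly.BMultinom mj)) //= eqxx mulr1 big1 ?addr0 // => m' m'm.
      by rewrite -val_eqE /= in m'm; rewrite (negbTE m'm) mulr0.
    rewrite big1 ?normr0 ?exprn_ge0 // => m' _.
    case: eqP => [mm'|_]; last by rewrite mulr0.
    by move: (mpoly.bmdeg m'); rewrite mm' ltnNge mj.
  exists p => //; rewrite /rat_eval /p raddf_sum; apply: eq_bigr => m _ /=.
  by rewrite mpoly.mmapZ mpoly.mmapX.
pose f : {ffun mpoly.bmultinom n j.+1 -> 'I_(2 ^ j.+1).+1} :=
  [ffun m => inord (absz (mpoly.mcoeff (mpoly.bmnm m) p + 2 ^+ j))].
exists f; rewrite /rat_eval (mpoly.mmapE j.+1) //.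
apply: eq_bigr => m _; congr (_%:~R * _).
rewrite /grid_coef ffunE.
have := cp (mpoly.bmnm m); rewrite ler_norml => /andP[c1 c2].
have c0 : 0 <= mpoly.mcoeff (mpoly.bmnm m) p + 2 ^+ j by rewrite -lerBlDr sub0r.
rewrite inordK ?gez0_abs ?addrK //.
by rewrite ltnS -lez_nat gez0_abs // -natz natrX -[2%:R]/2 exprS mulr_natl mulr2n lerD2r.
Qed.

Lemma grid_uniq j : uniq (grid j).
Proof. exact: undup_uniq. Qed.

Lemma grid_le j x : x \in grid j -> x \in grid j.+1.
Proof.
move=> /gridP[p sp <-]; apply/gridP; exists p => //.
case: sp => [szp cp]; split=> [|m]; first exact: leqW.
by apply: le_trans (cp m) _; rewrite ler_eXn2l.
Qed.

Lemma grid_add j x y : x \in grid j -> y \in grid j -> x + y \in grid j.+1.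
Proof.
move=> /gridP[p sp <-] /gridP[q sq <-]; apply/gridP; exists (p + q).
  exact: small_polyD.
exact: rat_evalD.
Qed.

Lemma grid_add_scaled j x y r : r \in rs -> x \in grid j -> y \in grid j ->
  x + r * y \in grid j.+1.
Proof.
move=> /(nthP 0)[i ltin <-] /gridP[p sp <-] /gridP[q sq <-]; apply/gridP.
exists (p + q * mpoly.mpolyX int (mpoly.mnm1 (Ordinal ltin))).
  exact: small_poly_addMX.
by rewrite rat_evalD rat_evalMX mulrC.
Qed.

(** The constants 0, ..., 2^j are distinct values. *)
Lemma size_grid_ge j : (2 ^ j < size (grid j))%N.
Proof.
have <- : size [seq i%:R : rat | i <- iota 0 (2 ^ j).+1] = (2 ^ j).+1.
  by rewrite size_map size_iota.
apply: uniq_leq_size.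
  rewrite map_inj_uniq ?iota_uniq // => a b /eqP.
  by rewrite eqr_nat => /eqP.
move=> x /mapP[i]; rewrite mem_iota add0n ltnS => /= i2 ->; apply/gridP.
exists (mpoly.mpolyC n i%:Z).
  apply: small_polyC; rewrite ger0_norm // -natz -[2]/(2%:R) -natrX.
  by rewrite ler_nat.
by rewrite /rat_eval mpoly.mmapC.
Qed.

Lemma card_bmultinom_le j : (#|{: mpoly.bmultinom n j.+1}| <= j.+1 ^ n)%N.
Proof.
pose h (m : mpoly.bmultinom n j.+1) : {ffun 'I_n -> 'I_j.+1} :=
  [ffun i => inord (mpoly.bmnm m i)].
have ltj (m : mpoly.bmultinom n j.+1) i : (mpoly.bmnm m i < j.+1)%N.
  apply: leq_ltn_trans (mpoly.bmdeg m).
  by rewrite mpoly.mdegE (bigD1 i) //= leq_addr.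
have h_inj : injective h.
  move=> m m' /ffunP hm; apply/val_inj/mpoly.mnmP => i /=.
  by move: (hm i); rewrite !ffunE => /(congr1 val); rewrite /= !inordK.
by apply: leq_trans (leq_card h h_inj) _; rewrite card_ffun !card_ord.
Qed.

Lemma size_grid_le j : (size (grid j) <= 2 ^ (j.+2 * j.+1 ^ n))%N.
Proof.
apply: leq_trans (size_undup _) _; rewrite size_codom card_ffun card_ord.
apply: (@leq_trans ((2 ^ j.+2) ^ #|{: mpoly.bmultinom n j.+1}|)).
  case: #|_| => [|e] //; rewrite leq_exp2r //.
  by rewrite [X in (_ <= X)%N]expnS mul2n -addnn -addn1 leq_add ?expn_gt0.
by rewrite -expnM leq_exp2l // leq_mul2l card_bmultinom_le orbT.
Qed.

(** A collision would give s = (p' - p) / (q - q'), and differences of level j polynomials have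
    level j + 1. *)
Lemma grid_injective j s : ~ rational_expr rs s j.+1 ->
  forall x y x' y', x \in grid j -> y \in grid j -> x' \in grid j -> y' \in grid j ->
  x + s * y = x' + s * y' -> x = x' /\ y = y'.
Proof.
move=> not_expr _ _ _ _ /gridP[p sp <-] /gridP[q sq <-] /gridP[p' sp' <-]
  /gridP[q' sq' <-] E.
have [qq'|qq'] := eqVneq (rat_eval q) (rat_eval q').
  by split=> //; move: E; rewrite qq' => /addIr.
case: not_expr; exists (p' - p), (q - q').
rewrite !rat_evalB subr_eq0 qq'; split=> //; [exact: small_polyB..|].
have qq0 : rat_eval q - rat_eval q' != 0 by rewrite subr_eq0.
apply: (mulIf qq0); rewrite divfK //.
have -> : s * (rat_eval q - rat_eval q') =
  (rat_eval p + s * rat_eval q) - rat_eval p - s * rat_eval q' by ring.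
by rewrite E; ring.
Qed.

End Grid.

(** * The lower bound *)

Section UniformEntropy.
Context {R : realType}.

Lemma sum_Prob_eq (Om : finType) (P : fdist R Om) (T : eqType) (Z : Om -> T)
    (s : seq T) : uniq s -> (forall w, Z w \in s) ->
  \sum_(z <- s) Prob_eq P Z z = 1.
Proof.
move=> s_uniq Zs; rewrite -(Defs.pmf_sum1 P) /Prob_eq.
rewrite (exchange_big_dep predT) //=; apply: eq_bigr => w _.
rewrite -big_filter.
have -> : [seq z <- s | Z w == z] = [:: Z w].
  rewrite (eq_filter (a2 := pred1 (Z w))); last by move=> z; rewrite /= eq_sym.
  by rewrite filter_pred1_uniq.
by rewrite big_seq1.
Qed.

(** Gibbs' inequality against the uniform law on [s]: termwise ln x <= x - 1 at x = 1 / (p |s|), and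
    the bounds sum to 0. *)
Lemma entropy_le_ln_size (Om : finType) (P : fdist R Om) (T : eqType)
    (Z : Om -> T) (s : seq T) : uniq s -> (forall w, Z w \in s) ->
  entropy P Z <= ln (size s)%:R.
Proof.
move=> s_uniq Zs; have sum1 := sum_Prob_eq P s_uniq Zs.
have s0 : 0 < (size s)%:R :> R.
  rewrite ltr0n lt0n size_eq0; apply/eqP => s0; move: sum1.
  by rewrite s0 big_nil => /eqP; rewrite eq_sym oner_eq0.
rewrite (entropy_sup_codom P s_uniq) => [|_ /codomP[w ->] //].
rewrite -subr_le0 -[ln (size s)%:R]mul1r -[X in _ - X * _]sum1 big_distrl /= -sumrB.
apply: le_trans (_ : \sum_(z <- s) ((size s)%:R^-1 - Prob_eq P Z z) <= _); last first.
  rewrite sumrB sum1 big_const_seq count_predT iter_addr addr0.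
  by rewrite -[_^-1 *+ _]mulr_natr mulVf ?subrr // gt_eqF.
apply: ler_sum => z _; set p := Prob_eq P Z z.
have [p0|p0] := ltP 0 p; last first.
  have -> : p = 0 by apply/eqP; rewrite eq_le p0 Prob_eq_ge0.
  by rewrite !mul0r !subr0 invr_ge0 ltW.
rewrite -mulrBr -ln_div ?posrE ?invr_gt0 //.
have -> : (size s)%:R^-1 - p = p * (p^-1 / (size s)%:R - 1).
  by rewrite mulrBr mulr1 mulrA divff ?gt_eqF // mul1r.
rewrite ler_pM2l //.
have q0 : 0 < p^-1 / (size s)%:R by rewrite divr_gt0 ?invr_gt0.
have := @le_ln1Dx R (p^-1 / (size s)%:R - 1).
by rewrite (addrC 1) subrK; apply; rewrite ltrBrDl subrr.
Qed.

Section Uniform.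
Context {Om : finType} (w0 : Om).

Lemma uniform_ge0 (w : Om) : 0 <= #|Om|%:R^-1 :> R.
Proof. by rewrite invr_ge0. Qed.

Lemma uniform_sum1 : \sum_(w : Om) #|Om|%:R^-1 = 1 :> R.
Proof.
rewrite sumr_const -[_ *+ _]mulr_natl divff // pnatr_eq0 -lt0n.
by apply/card_gt0P; exists w0.
Qed.

Definition uniform : fdist R Om := FDist uniform_ge0 uniform_sum1.

Lemma entropy_uniform_inj (T : eqType) (Z : Om -> T) :
  injective Z -> entropy uniform Z = ln #|Om|%:R.
Proof.
move=> Zinj; rewrite entropyE.
under eq_bigr => w _.
  rewrite /Prob_eq (big_pred1 w) => [|v]; last by rewrite /= (inj_eq Zinj).
  rewrite /= invrK; over.
by rewrite -big_distrl /= uniform_sum1 mul1r.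
Qed.

End Uniform.
End UniformEntropy.

Section LowerBound.
Context {R : realType}.

Lemma max_proj_entropy_le (S : {fset slope}) (Om : finType) (P : fdist R Om)
    (X Y : Om -> rat) (B : R) : 0 <= B ->
  (forall r, r \in S -> proj_entropy P X Y r <= B) ->
  max_proj_entropy S P X Y <= B.
Proof.
by move=> B0 SB; rewrite /max_proj_entropy big_seq; apply: bigmax_le.
Qed.

Lemma mem_other_slopes (S : {fset slope}) q :
  Some q \in S -> [|| q == 0, q == 1 | q \in other_slopes S].
Proof.
move=> qS; have [//|q0] := eqVneq q 0; have [//|q1] := eqVneq q 1.
rewrite /other_slopes -(mem_map (@Some_inj _)); apply/mapP; exists q => //.
rewrite mem_pmap; apply/mapP; exists (Some q) => //.
rewrite in_fsetD qS !inE andbT !negb_or andbT.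
by apply/andP; split; apply/eqP => -[] /eqP; apply/negP.
Qed.

(** Tested on a uniform bit X and Y = 0, where all finite slopes give entropy ln 2. This settles
    small D and allows multiplying inequalities by C. *)
Lemma exponent_ge1 (S : {fset slope}) (s : rat) (C : R) :
  (base_slopes `<=` S)%fset -> sum_difference_exponent S (Some s) C -> 1 <= C.
Proof.
move=> baseS expC.
pose X (b : bool) : rat := b%:R; pose Y (b : bool) : rat := 0.
have X_inj : injective X by move=> [] [].
pose P : fdist R bool := uniform true.
have HX r : proj_entropy P X Y (Some r) = ln 2.
  have <- : entropy P X = ln 2 by rewrite entropy_uniform_inj // card_bool.
  by apply: entropy_eq_ker => w v; rewrite /Y /= mulr0 !addr0.
have ln2 : 0 < ln 2 :> R by rewrite ln_gt0 // ltr1n.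
have max_eq : max_proj_entropy S P X Y = ln 2.
  apply/eqP; rewrite eq_le; apply/andP; split.
    apply: max_proj_entropy_le => [|r _]; first exact: ltW.
    have <- : entropy P id = ln 2 by rewrite entropy_uniform_inj // card_bool.
    by apply: entropy_mono => w v ->.
  rewrite -(HX 0); apply: proj_entropy_le_max.
  by rewrite (fsubsetP baseS) // !inE eqxx.
have := expC bool P X Y; rewrite HX max_eq -[X in X <= _]mul1r.
by rewrite ler_pM2r.
Qed.

Lemma grid_exponent_le (S : {fset slope}) (s : rat) (C : R) j :
  let a i := ln (size (grid (other_slopes S) i))%:R : R in
  (base_slopes `<=` S)%fset -> ~ rational_expr (other_slopes S) s j.+1 ->
  sum_difference_exponent S (Some s) C -> 2 * a j <= C * a j.+1.
Proof.
move=> a baseS not_expr expC; have C1 := exponent_ge1 baseS expC.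
set rs := other_slopes S in a not_expr *.
set A := grid rs j.
have A0 : (0 < size A)%N by apply: leq_ltn_trans (size_grid_ge rs j).
pose w0 := (Ordinal A0, Ordinal A0).
pose X (w : 'I_(size A) * 'I_(size A)) := A`_w.1.
pose Y (w : 'I_(size A) * 'I_(size A)) := A`_w.2.
have XA w : X w \in A by apply: mem_nth.
have YA w : Y w \in A by apply: mem_nth.
pose P : fdist R _ := uniform w0.
have a_ge0 i : 0 <= a i.
  by rewrite ln_ge0 // ler1n (leq_trans _ (size_grid_ge rs i)).
have max_le : max_proj_entropy S P X Y <= a j.+1.
  apply: max_proj_entropy_le => // -[r|] rS; rewrite /a;
    apply: entropy_le_ln_size (grid_uniq rs j.+1) _ => w /=; last exact: grid_le.
  have /or3P[/eqP->|/eqP->|rrs] := mem_other_slopes rS.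
  - by rewrite mul0r addr0; apply: grid_le.
  - by rewrite mul1r; apply: grid_add.
  - exact: grid_add_scaled.
have := expC _ P X Y; rewrite /proj_entropy entropy_uniform_inj => [|w v /=]; last first.
  move=> /(grid_injective not_expr (XA w) (YA w) (XA v) (YA v))[/eqP + /eqP].
  rewrite /X /Y !nth_uniq ?grid_uniq // => /eqP e1 /eqP e2.
  by case: w v e1 e2 => [w1 w2] [v1 v2] /= /val_inj -> /val_inj ->.
have -> : ln #|{: 'I_(size A) * 'I_(size A)}|%:R = 2 * a j :> R.
  rewrite card_prod card_ord natrM lnM ?posrE ?ltr0n // /a -/A.
  by rewrite mulr_natl mulr2n.
by move/le_trans; apply; rewrite ler_wpM2l // (le_trans ler01).
Qed.

Lemma ln2_ge : 1 / 2 <= ln 2 :> R.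
Proof.
have := @le_ln1Dx R (- (1 / 2)).
have -> : 1 + - (1 / 2) = 2^-1 :> R by field.
by rewrite lnV ?posrE // lerN2; apply; lra.
Qed.

Lemma ln2_gt0 : 0 < ln 2 :> R.
Proof. by have := ln2_ge; lra. Qed.

Lemma ln_size_grid_ge rs j : j%:R * ln 2 <= ln (size (grid rs j))%:R :> R.
Proof.
rewrite mulr_natl -lnXn // -natrX ler_ln ?posrE ?ltr0n ?expn_gt0 //; last first.
  exact: leq_ltn_trans (size_grid_ge rs j).
by rewrite ler_nat ltnW // size_grid_ge.
Qed.

Lemma ln_size_grid_le rs j :
  ln (size (grid rs j))%:R <= (j.+2 * j.+1 ^ size rs)%:R * ln 2 :> R.
Proof.
rewrite mulr_natl -lnXn // -natrX ler_ln ?posrE ?ltr0n ?expn_gt0 //; last first.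
  exact: leq_ltn_trans (size_grid_ge rs j).
by rewrite ler_nat size_grid_le.
Qed.

Lemma not_rational_expr (S : {fset slope}) s D :
  (D < rational_complexity S (Some s))%N -> ~ rational_expr (other_slopes S) s D.
Proof.
rewrite /rational_complexity; case: ex_minnP => m _ min_m ltDm exprD.
by move: ltDm; rewrite ltnNge min_m //; apply/asboolP.
Qed.

Lemma SD_ge (S : {fset slope}) (s : slope) (L : R) :
  (forall C : R, sum_difference_exponent S s C -> L <= C) -> (L%:E <= SD R S s)%E.
Proof.
by move=> LC; apply: le_ereal_inf_tmp => _ [C /LC LC' <-]; rewrite lee_fin.
Qed.

(** If each of the m steps multiplied [l] by more than E, the total growth would exceed E^m. *)
Lemma slow_step (l : nat -> R) (E : R) m : (0 < m)%N -> 0 <= E ->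
  l (m + m)%N <= E ^+ m * l m ->
  exists j, [/\ (m <= j)%N, (j < m + m)%N & l j.+1 <= E * l j].
Proof.
move=> m0 E0 l2m; apply/not_existsP => no_j.
have step j : (m <= j)%N -> (j < m + m)%N -> E * l j < l j.+1.
  move=> mj jm; rewrite ltNge; apply/negP => lj.
  by apply: (no_j j); split.
have grow i : (i < m)%N -> E ^+ i.+1 * l m < l (m + i.+1)%N.
  elim: i => [|i IH] im; first by rewrite expr1 addn1 step // -[ltnLHS]addn0 ltn_add2l.
  rewrite addnS; apply: le_lt_trans (step _ _ _); rewrite ?leq_addr ?ltn_add2l //.
  by rewrite exprS -mulrA ler_wpM2l // ltW // IH // ltnW.
by have := grow m.-1; rewrite prednK // leqnn => /(_ isT); rewrite ltNge l2m.
Qed.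

Lemma SD_lower_base (S : {fset slope}) (s : slope) :
  (base_slopes `<=` S)%fset -> #|` S|%fset = 3%N -> s \notin S ->
  ((2 - 6 / (maxn 1 (rational_complexity S s))%:R)%:E <= SD R S s)%E.
Proof.
case: s => [s|] baseS cardS sS; last first.
  by move: sS; rewrite (fsubsetP baseS) // !inE eqxx !orbT.
apply: SD_ge => C expC; have C1 := exponent_ge1 baseS expC.
set D0 := rational_complexity S (Some s).
have [D2|D2] := leqP D0 1; first by rewrite divr1; lra.
have szrs := @size_other_slopes S 0 baseS cardS.
(* The largest j with j + 1 below the complexity. The sizes at levels j and j + 1 then give C >= 2j
   / (j + 3) = 2 - 6 / (j + 3). *)
have [j Dj] : exists j, D0 = j.+2 by case: D0 D2 => [|[|j]] // _; exists j.
have not_expr : ~ rational_expr (other_slopes S) s j.+1.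
  by apply: not_rational_expr; rewrite -/D0 Dj.
have := grid_exponent_le baseS not_expr expC.
have := ln_size_grid_ge (other_slopes S) j.
have := ln_size_grid_le (other_slopes S) j.+1.
rewrite szrs expn0 muln1.
set a := ln (size (grid _ j.+1))%:R; set b := ln (size (grid _ j))%:R.
move=> a_le b_ge main.
have {}main : 2 * j%:R <= C * j.+3%:R.
  rewrite -(ler_pM2r ln2_gt0) -!mulrA.
  apply: le_trans (_ : 2 * b <= _); first by rewrite ler_pM2l.
  by apply: le_trans main _; rewrite ler_wpM2l // (le_trans ler01).
have d0 : 0 < D0%:R :> R by rewrite Dj ltr0n.
have : 6 / j.+3%:R <= 6 / D0%:R :> R.
  by rewrite Dj ler_pM2l // lef_pV2 ?posrE ?ltr0n // ler_nat.
have : 2 - 6 / j.+3%:R <= C.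
  have j3 : 0 < j.+3%:R :> R by rewrite ltr0n.
  rewrite -(ler_pM2r j3) mulrBl divfK ?gt_eqF //; apply: le_trans main.
  by rewrite -(addn3 j) natrD; lra.
by move=> le_C le_D; apply: le_trans le_C; rewrite lerD2l lerN2.
Qed.

Lemma SD_lower (k : nat) (S : {fset slope}) (s : slope) :
  (base_slopes `<=` S)%fset -> #|` S|%fset = (k + 3)%N -> s \notin S ->
  let D : R := (maxn 1 (rational_complexity S s))%:R in
  ((2 - (12 * k.+2)%:R * ln (2 + D) / D)%:E <= SD R S s)%E.
Proof.
case: s => [s|] baseS cardS sS; last first.
  by move: sS; rewrite (fsubsetP baseS) // !inE eqxx !orbT.
set D0 := rational_complexity S (Some s).
have szrs := size_other_slopes baseS cardS; set rs := other_slopes S in szrs.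
rewrite /=; set D : R := (maxn 1 D0)%:R.
apply: SD_ge => C expC; have C1 := exponent_ge1 baseS expC.
have D_ge1 : 1 <= D by rewrite ler1n leq_max.
have D_gt0 : 0 < D by apply: lt_le_trans D_ge1.
have lnD_ge : 1 / 2 <= ln (2 + D).
  apply: le_trans ln2_ge _; rewrite ler_ln ?posrE ?addr_gt0 //; lra.
(* For complexity at most 2 the claimed bound is at most 1, hence at most C. *)
have [D2|D3] := leqP D0 2.
  have D_le2 : D <= 2 by rewrite /D ler_nat geq_max D2.
  suff : 1 <= (12 * k.+2)%:R * ln (2 + D) / D by lra.
  rewrite ler_pdivlMr // mul1r; apply: le_trans D_le2 _.
  apply: (@le_trans _ _ (4 * (1 / 2))); first by lra.
  have k4 : 4 <= (12 * k.+2)%:R :> R.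
    by rewrite ler_nat; apply: (@leq_trans 12); rewrite ?leq_pmulr.
  by apply: ler_pM k4 lnD_ge; rewrite ?divr_ge0.
have DE : D = D0%:R by rewrite /D (maxn_idPr _) // ltnW // ltnW.
(* Any j with m <= j < 2m then satisfies j + 1 < D0, as injectivity requires, while D0 <= 6m keeps m
   comparable to D. *)
pose m := (D0.-1)./2.
have m0 : (0 < m)%N by rewrite /m half_gt0 -ltnS (ltn_predK D3).
have mD : (m + m < D0)%N.
  rewrite addnn -[ltnRHS](ltn_predK D3) ltnS.
  by rewrite -[leqRHS](odd_double_half D0.-1) leq_addl.
have Dm : (D0 <= 6 * m)%N.
  have : (D0.-1 <= 1 + m + m)%N.
    by rewrite -[leqLHS](odd_double_half D0.-1) -addnn addnA !leq_add2r leq_b1.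
  by lia.
pose l i : R := ln (size (grid rs i))%:R.
have mR0 : 0 < m%:R :> R by rewrite ltr0n.
(* [B] bounds l(2m) / l(m), since 2m + 2 <= 4m; [gam] is chosen so that [expR gam] is the m-th root
   of [B]. *)
pose B : R := 4 * (m + m).+1%:R ^+ k.
have B1 : 1 <= B by rewrite /B mulr_ege1 ?exprn_ege1 ?ler1n.
pose gam : R := ln B / m%:R.
have l2m : l (m + m)%N <= expR gam ^+ m * l m.
  rewrite -expRM_natl /gam (mulrC m%:R) divfK ?gt_eqF // lnK ?posrE ?(lt_le_trans ltr01) //.
  apply: le_trans (ln_size_grid_le rs _) _.
  apply: le_trans (_ : B * (m%:R * ln 2) <= _); last first.
    by rewrite ler_wpM2l ?ln_size_grid_ge // (le_trans ler01).
  rewrite szrs mulrA ler_wpM2r ?(ltW ln2_gt0) // natrM natrX.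
  have -> : B * m%:R = (4 * m%:R) * (m + m).+1%:R ^+ k by rewrite /B; ring.
  rewrite ler_wpM2r ?exprn_ge0 //.
  by rewrite -natrM ler_nat; lia.
have [j [mj jm lj]] := slow_step m0 (expR_ge0 _) l2m.
have not_expr : ~ rational_expr rs s j.+1.
  by apply: not_rational_expr; rewrite -/D0 (leq_ltn_trans jm).
have main := grid_exponent_le baseS not_expr expC.
rewrite -/rs -/(l j) -/(l j.+1) in main.
have lj0 : 0 < l j.
  apply: lt_le_trans (ln_size_grid_ge rs j); rewrite mulr_gt0 ?ln2_gt0 // ltr0n.
  exact: leq_trans mj.
have C2 : 2 <= C * expR gam.
  rewrite -(ler_pM2r lj0) -mulrA; apply: le_trans main _.
  by rewrite ler_wpM2l // (le_trans ler01).
have {}C2 : 2 * (1 - gam) <= C.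
  apply: le_trans (_ : 2 * expR (- gam) <= _).
    by rewrite ler_pM2l // expR_ge1Dx.
  by rewrite expRN ler_pdivrMr ?expR_gt0.
apply: le_trans C2; rewrite mulrBr mulr1 lerD2l lerN2.
(* Here 4 <= (2 + D)^2 and 2m + 1 <= 2 + D. The final 12 is the 2 of [2 * gam] times the 6 of D <=
   6m. *)
have lnB : ln B <= k.+2%:R * ln (2 + D).
  rewrite mulr_natl -lnXn ?ler_ln ?posrE ?exprn_gt0 ?addr_gt0 ?(lt_le_trans ltr01) //.
  rewrite /B -[k.+2]/(2 + k)%N exprD; apply: ler_pM => //; rewrite ?exprn_ge0 //.
    have D2 : 2 <= 2 + D by rewrite lerDl ltW.
    have -> : 4 = 2 * 2 :> R by rewrite -natrM.
    by rewrite expr2 ler_pM.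
  rewrite lerXn2r ?nnegrE ?addr_ge0 ?(ltW D_gt0) // DE -[2]/2%:R -natrD ler_nat.
  by apply: leq_trans mD _; rewrite leq_addl.
rewrite ler_pdivlMr // /gam mulrA mulrAC ler_pdivrMr //.
apply: le_trans (_ : 2 * (k.+2%:R * ln (2 + D)) * (6 * m%:R) <= _).
  rewrite ler_pM ?mulr_ge0 ?(ltW D_gt0) ?ln_ge0 // ?ler_pM2l //.
  by rewrite DE -natrM ler_nat.
by rewrite natrM le_eqVlt; apply/orP; left; apply/eqP; ring.
Qed.

End LowerBound.

Theorem theorem1p2 (R : realType) :
  (exists c1 c2 : R, [/\ 0 < c1, c1 < c2 &
     forall (S : {fset slope}) (s : slope),
       (base_slopes `<=` S)%fset -> #|` S|%fset = 3%N -> s \notin S ->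
       let D : R := (maxn 1 (rational_complexity S s))%:R in
       ((2 - c2 / D)%:E <= SD R S s)%E /\ (SD R S s <= (2 - c1 / D)%:E)%E])
  /\
  (forall k : nat, exists ck Ck : R, [/\ 0 < ck, 0 < Ck &
     forall (S : {fset slope}) (s : slope),
       (base_slopes `<=` S)%fset -> #|` S|%fset = (k + 3)%N -> s \notin S ->
       let D : R := (maxn 1 (rational_complexity S s))%:R in
       ((2 - Ck * ln (2 + D) / D)%:E <= SD R S s)%E /\
       (SD R S s <= (2 - ck / D ^+ k.+1)%:E)%E]).
Proof.
split.
  (* Enlarging the 6 of the lower bound to [c + 6] only weakens it and makes the two constants
     strictly ordered. *)
  have [c c0 upper] := @SD_upper R 0; exists c, (c + 6); split=> //; first by rewrite ltrDl.
  move=> S s baseS cardS sS D.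
  have D0 : 0 < D by rewrite ltr0n leq_max.
  split; last by rewrite -[D]expr1; apply: upper.
  apply: le_trans (SD_lower_base baseS cardS sS); rewrite lee_fin lerD2l lerN2.
  by rewrite ler_wpM2r ?invr_ge0 ?(ltW D0) // lerDr ltW.
move=> k; have [c c0 upper] := @SD_upper R k.
exists c, (12 * k.+2)%:R; split=> //.
by move=> S s baseS cardS sS D; split; [apply: SD_lower | apply: upper].
Qed.
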